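(* Let $d\ge 1$ be an integer and $\beta>0$ be fixed, and for each $N$ let $D_N$ be the graph-theoretical diameter of the long-range percolation random graph $G(N)$ on $\{0,1,\dots,N\}^d$ with critical exponent $s=d$ and parameter $\beta$. Then for any $\varepsilon>0$, $$\lim_{N\to\infty}\mathbb{P}\left(D_N\le \frac{(1+\varepsilon)\,d\log N}{\log\log N}\right)=1.$$ In particular, $D_N\,\frac{\log\log N}{\log N}\to d$ in probability as $N\to\infty$.
   Context: For an integer $N\ge 1$ write $[N]^d:=\{0,1,\dots,N\}^d\subset\mathbb{Z}^d$ and let $\|x\|$ be the $\ell^1$-norm of $x\in\mathbb{Z}^d$. Fix $\beta>0$. The random graph $G(N)$ has vertex set $[N]^d$, and every pair of distinct sites $x,y\in[N]^d$ is independently connected by an edge with probability $1$ if $\|x-y\|=1$, and with probability $1-\exp\left(-\frac{\beta}{\|x-y\|^d}\right)$ otherwise. $D(x,y)$ denotes the graph-theoretical distance between $x$ and $y$ in $G(N)$, and $D_N:=\max_{x,y\in[N]^d}D(x,y)$ is the associated diameter of $G(N)$. *)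

(* Defs.v *)
From HB Require Import structures.
From mathcomp Require Import all_boot all_order all_algebra.
From mathcomp Require Import all_classical all_reals all_analysis.

Set Implicit Arguments.
Unset Strict Implicit.
Unset Printing Implicit Defensive.

Import Order.TTheory GRing.Theory Num.Theory.
Import numFieldNormedType.Exports.

Local Open Scope classical_set_scope.
Local Open Scope ring_scope.

(* The box {0, ..., N}^d. *)
Definition site (d N : nat) := {ffun 'I_d -> 'I_N.+1}.

Definition l1dist (d N : nat) (x y : site d N) : nat :=
  (\sum_(i < d) `|(x i)%:Z - (y i)%:Z|)%N.

(* A simple graph on V is given by its set of edges, an edge being a set of
   two distinct vertices. *)
Definition pairs (V : finType) : {set {set V}} :=
  [set e : {set V} | #|e| == 2%N]%SET.

Definition adj (V : finType) (E : {set {set V}}) : rel V :=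
  fun x y => (x != y) && ([set x; y]%SET \in E).

(* Distances and diameters are extended reals: the distance between vertices
   in different connected components is +oo, as ereal_inf set0 = +oo. *)
Definition gdist (R : realType) (V : finType) (E : {set {set V}}) (x y : V) :
    \bar R :=
  ereal_inf [set ((size p)%:R : R)%:E |
    p in [set p : seq V | path (adj E) x p /\ last x p = y]].

Definition gdiam (R : realType) (V : finType) (E : {set {set V}}) : \bar R :=
  (\big[maxe/-oo]_(x : V) \big[maxe/-oo]_(y : V) gdist R E x y)%E.

Definition edge_prob (R : realType) (d N : nat) (beta : R) (x y : site d N) :
    R :=
  if l1dist x y == 1%N then 1
  else 1 - expR (- (beta / (l1dist x y)%:R ^+ d)).

Definition mutually_independent (R : realType) (disp : measure_display)
    (T : measurableType disp) (P : probability T R) (I : finType)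
    (A : {set I}) (F : I -> set T) : Prop :=
  forall J : {set I}, J \subset A ->
    P (\bigcap_(i in [set` J]) F i) = (\prod_(i in J) P (F i))%E.

Definition edge_event (T : Type) (V : finType) (G : T -> {set {set V}})
    (e : {set V}) : set T :=
  [set w | e \in G w].

Record long_range_percolation (R : realType) (d N : nat) (beta : R)
    (disp : measure_display) (T : measurableType disp) (P : probability T R)
    (G : T -> {set {set site d N}}) : Prop := LongRangePercolation {
  lrp_simple : forall w, G w \subset pairs (site d N);
  lrp_measurable : forall e, measurable (edge_event G e);
  lrp_prob : forall x y, x != y ->
    P (edge_event G [set x; y]%SET) = (edge_prob beta x y)%:E;
  lrp_independent : mutually_independent P (pairs (site d N)) (edge_event G)
}.

(* Each X N may live on its own probability space; the limit is a constant. *)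
Definition cvg_in_probability (R : realType) (disp : nat -> measure_display)
    (T : forall N, measurableType (disp N)) (P : forall N, probability (T N) R)
    (X : forall N, T N -> \bar R) (c : R) : Prop :=
  forall delta : R, 0 < delta ->
    P N [set w | (delta%:E < `|X N w - c%:E|)%E] @[N --> \oo] --> 0%E.

(* Main.v *)
Require Import Defs.
From mathcomp Require Import all_boot all_order all_algebra.
From mathcomp Require Import reals sequences exp.
From mathcomp Require Import zify lra ring.
Set Implicit Arguments.
Unset Strict Implicit.
Unset Printing Implicit Defensive.
Import Order.TTheory GRing.Theory Num.Theory.
Local Open Scope ring_scope.

(** Write L for log N and l for log log N. A vertex has about C L neighbours in
    mean, spread evenly over all logarithmic scales of length, since the sum of
    ||x||^-d over the box is of order L.

    Lower bound on the diameter. A vertex reaches in mean at most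
    (C L)^0 + ... + (C L)^n vertices by walks of length at most n, because the
    edges of a self-avoiding walk are distinct and hence independent
    ([sum_prob_saw]). Having all (N+1)^d vertices within distance n of a given
    one is therefore unlikely as long as n (l + log C) stays below d L, that is
    for n up to (1 - eps) d L / l ([prob_all_dist_le], [walks_negligible]).

    Upper bound. Explore the graph from x in layers, looking only for vertices
    not seen before. Edges longer than N^(3/4) alone give a layer of s vertices
    at least c s L new neighbours in mean, as long as the set of vertices seen
    is much smaller than N^(3d/4), and the number of new neighbours is below a
    small multiple of s L with probability exp(- c s L) only
    ([prob_nbr_small]). With s at least a large constant this beats any power
    of N, which is why the exploration starts from a set of a vertices near x,
    reached by nearest-neighbour steps, and not from x alone. After
    k = (d/2 + o(1)) L / l rounds the layer has about N^(d/2) L vertices. The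
    same is done from y, avoiding everything seen from x. The last layers of
    the two explorations are disjoint and no edge between them has been
    inspected; two sets of that size are joined by an edge except with
    probability exp(- c L^2). So x and y are within 2 k + 1 + 2 a of each other
    except with probability N^(- 2 d - 1), which survives the union bound over
    all pairs ([prob_meet_fails], [prob_diam_large]).

    Conditioning on the explored part is replaced by independence of functions
    of disjoint sets of edges, in the finite product measure [weight]
    ([expectM]); [lawE] identifies it with the law of the percolation graph. *)

(** * Random subsets with independent coordinates *)

Section RandomSubset.
Variables (R : realType) (I : finType) (p : I -> R).
Hypothesis p01 : forall i, 0 <= p i <= 1.

Definition weight (E : {set I}) : R :=
  \prod_i (if i \in E then p i else 1 - p i).

Definition expect (f : {set I} -> R) : R := \sum_E weight E * f E.

Definition prob (Q : pred {set I}) : R := expect (fun E => (Q E)%:R).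

Definition depends_on (T : Type) (J : {set I}) (f : {set I} -> T) :=
  forall E F, E :&: J = F :&: J -> f E = f F.

Lemma weight_ge0 E : 0 <= weight E.
Proof.
apply: prodr_ge0 => i _; case/andP: (p01 i) => p0 p1.
by case: ifP => // _; rewrite subr_ge0.
Qed.

Lemma expect_prod_coord (a b : I -> R) :
  expect (fun E => \prod_i (if i \in E then a i else b i)) =
  \prod_i (p i * a i + (1 - p i) * b i).
Proof.
rewrite bigA_distr; apply: eq_bigr => E _.
by rewrite /weight -big_split; apply: eq_bigr => i _ /=; case: ifP.
Qed.

Lemma eq_expect f g : f =1 g -> expect f = expect g.
Proof. by move=> fg; apply: eq_bigr => E _; rewrite fg. Qed.

Lemma expect_cst c : expect (fun=> c) = c.
Proof.
rewrite /expect -mulr_suml.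
suff -> : \sum_E weight E = 1 by rewrite mul1r.
transitivity (expect (fun E => \prod_i (if i \in E then 1 else 1))).
  apply: eq_bigr => E _; rewrite big1 ?mulr1 // => i _; by case: ifP.
by rewrite expect_prod_coord big1 // => i _; rewrite !mulr1 subrKC.
Qed.

Lemma expectD f g : expect (fun E => f E + g E) = expect f + expect g.
Proof. by rewrite -big_split; apply: eq_bigr => E _; rewrite mulrDr. Qed.

Lemma expectZ c f : expect (fun E => c * f E) = c * expect f.
Proof. by rewrite mulr_sumr; apply: eq_bigr => E _; rewrite mulrCA. Qed.

Lemma expect_sum (K : Type) (r : seq K) (P : pred K) (f : K -> {set I} -> R) :
  expect (fun E => \sum_(k <- r | P k) f k E) =
  \sum_(k <- r | P k) expect (f k).
Proof.
by rewrite exchange_big /=; apply: eq_bigr => E _; rewrite mulr_sumr.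
Qed.

Lemma ler_expect f g : (forall E, f E <= g E) -> expect f <= expect g.
Proof. by move=> fg; apply: ler_sum => E _; rewrite ler_wpM2l ?weight_ge0. Qed.

Lemma expect_ge0 f : (forall E, 0 <= f E) -> 0 <= expect f.
Proof. by move=> f0; apply: sumr_ge0 => E _; rewrite mulr_ge0 ?weight_ge0. Qed.

Lemma prob_ge0 Q : 0 <= prob Q.
Proof. exact/expect_ge0. Qed.

Lemma le_prob (Q Q' : pred {set I}) :
  (forall E, Q E -> Q' E) -> prob Q <= prob Q'.
Proof.
move=> QQ; apply: ler_expect => E; case: (boolP (Q E)) => [/QQ -> //|_].
exact: ler0n.
Qed.

Lemma eq_prob (Q Q' : pred {set I}) : Q =1 Q' -> prob Q = prob Q'.
Proof. by move=> QQ; apply: eq_expect => E; rewrite QQ. Qed.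

Lemma prob_eq0 (Q : pred {set I}) : Q =1 pred0 -> prob Q = 0.
Proof.
by move=> Q0; rewrite -[RHS](expect_cst 0); apply: eq_expect => E; rewrite Q0.
Qed.

Lemma prob_le1 Q : prob Q <= 1.
Proof.
rewrite -[leRHS](expect_cst 1); apply: ler_expect => E; by rewrite lern1 leq_b1.
Qed.

Lemma prob_or (Q Q' : pred {set I}) :
  prob (fun E => Q E || Q' E) <= prob Q + prob Q'.
Proof.
rewrite -expectD; apply: ler_expect => E.
by case: (Q E); case: (Q' E); rewrite /= ?addr0 ?add0r // lerDl.
Qed.

Lemma prob_exists (K : finType) (Q : K -> pred {set I}) :
  prob (fun E => [exists k, Q k E]) <= \sum_k prob (Q k).
Proof.
rewrite -expect_sum; apply: ler_expect => E.
case: existsP => [[k Qk]|_] /=; last by apply: sumr_ge0.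
by rewrite (bigD1 k) //= Qk lerDl sumr_ge0.
Qed.

Lemma prob_cmpl Q : prob (fun E => ~~ Q E) = 1 - prob Q.
Proof.
apply: (@addrI _ (prob Q)); rewrite addrC subrKC -expectD.
rewrite -[RHS](expect_cst 1); apply: eq_expect => E.
by case: (Q E); rewrite /= ?addr0 ?add0r.
Qed.

Lemma prob_markov (f : {set I} -> R) (c : R) (Q : pred {set I}) :
  (forall E, 0 <= f E) -> (forall E, Q E -> c <= f E) ->
  c * prob Q <= expect f.
Proof.
move=> f0 fc; rewrite -expectZ; apply: ler_expect => E.
by case: (boolP (Q E)) => [/fc|_]; rewrite ?mulr1 ?mulr0.
Qed.

(** Coordinates in J may be exchanged between two independent copies of the
    random set without changing their joint law; after the exchange both f and
    g are evaluated at the same copy. *)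
Lemma expectM (J : {set I}) f g :
  depends_on J f -> depends_on (~: J) g ->
  expect (fun E => f E * g E) = expect f * expect g.
Proof.
move=> fJ gJ; pose mix (E F : {set I}) := (E :&: J) :|: (F :\: J).
pose swap (u : {set I} * {set I}) := (mix u.1 u.2, mix u.2 u.1).
have mixJ E F : mix E F :&: J = E :&: J.
  by apply/setP => i; rewrite !inE; case: (i \in J); rewrite ?andbF ?andbT ?orbF.
have mixCJ E F : mix E F :&: ~: J = F :&: ~: J.
  by apply/setP => i; rewrite !inE; case: (i \in J); rewrite ?andbF ?andbT.
have swapK : involutive swap.
  move=> [E F]; congr pair; apply/setP => i; rewrite !inE;
  by case: (i \in J); rewrite ?andbF ?andbT ?orbF.
have wmix E F : weight (mix E F) * weight (mix F E) = weight E * weight F.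
  rewrite /weight -!big_split; apply: eq_bigr => i _ /=; rewrite !inE.
  case: (i \in J); rewrite ?andbF ?andbT ?orbF //=.
  exact: mulrC.
rewrite /expect big_distrlr pair_bigA /= [RHS](reindex_inj (inv_inj swapK)) /=.
rewrite -[LHS]mulr1 -(expect_cst 1) /expect big_distrlr pair_bigA /=.
apply: eq_bigr => -[E F] _ /=.
rewrite mulrACA [RHS]mulrACA wmix mulr1.
by rewrite (fJ _ _ (mixJ E F)) (gJ _ _ (mixCJ F E)).
Qed.

Lemma agreeW (J J' E F : {set I}) :
  J \subset J' -> E :&: J' = F :&: J' -> E :&: J = F :&: J.
Proof. by move=> JJ EF; rewrite -(setIidPr JJ) !setIA EF. Qed.

Lemma agree_mem (J E F : {set I}) i :
  i \in J -> E :&: J = F :&: J -> (i \in E) = (i \in F).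
Proof.
have gen (X : {set I}) : i \in J -> (i \in X :&: J) = (i \in X).
  by rewrite in_setI => ->; rewrite andbT.
by move=> iJ EF; rewrite -gen // EF gen.
Qed.

Lemma expect_prod (K : eqType) (r : seq K) (J : K -> {set I})
    (f : K -> {set I} -> R) :
  uniq r -> (forall k, depends_on (J k) (f k)) ->
  (forall k l, k != l -> [disjoint J k & J l]) ->
  expect (fun E => \prod_(k <- r) f k E) = \prod_(k <- r) expect (f k).
Proof.
move=> + fJ Jdis; elim: r => [|k r IH] /=.
  by move=> _; rewrite big_nil -[RHS](expect_cst 1);
     apply: eq_expect => E; rewrite big_nil.
move=> /andP[kr ur]; rewrite big_cons -IH // -(@expectM (J k)) //.
  by apply: eq_expect => E; rewrite big_cons.
move=> E F EF; apply: eq_big_seq => l lr; apply: (fJ l).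
have Jl : J l \subset ~: J k.
  by rewrite -disjoints_subset disjoint_sym Jdis //; apply: contraNneq kr => ->.
exact: agreeW Jl EF.
Qed.

Lemma prob_subset (J : {set I}) : prob (fun E => J \subset E) = \prod_(i in J) p i.
Proof.
transitivity (expect (fun E =>
    \prod_i (if i \in E then 1 else (i \notin J)%:R))).
  apply: eq_expect => E; case: (boolP (J \subset E)) => [/subsetP JE|].
    by rewrite big1 // => i _; case: ifP => // /negbT;
      case: (boolP (i \in J)) => // /JE ->.
  case/subsetPn => i iJ iE; rewrite (bigD1 i) //= (negPf iE) iJ mul0r //.
rewrite expect_prod_coord [RHS]big_mkcond; apply: eq_bigr => i _.
by case: (i \in J); rewrite /= ?mulr1 ?mulr0 ?addr0 ?subrKC.
Qed.

Lemma prob_disjoint (J : {set I}) :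
  prob (fun E => [disjoint J & E]) = \prod_(i in J) (1 - p i).
Proof.
transitivity (expect (fun E =>
    \prod_i (if i \in E then (i \notin J)%:R else 1))).
  apply: eq_expect => E; rewrite disjoints_subset.
  case: (boolP (J \subset ~: E)) => [/subsetP JE|].
    rewrite big1 // => i _; case: ifP => // iE.
    by case: (boolP (i \in J)) => // /JE; rewrite inE iE.
  case/subsetPn => i iJ; rewrite inE negbK => iE.
  by rewrite (bigD1 i) //= iE iJ mul0r.
rewrite expect_prod_coord [RHS]big_mkcond; apply: eq_bigr => i _.
by case: (i \in J); rewrite /= ?mulr1 ?mulr0 ?add0r ?subrKC.
Qed.

Lemma prob_mem i : prob (fun E => i \in E) = p i.
Proof.
transitivity (prob (fun E => [set i] \subset E)).
  by apply: eq_prob => E; rewrite sub1set.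
by rewrite prob_subset big_set1.
Qed.

End RandomSubset.

(** * Growth of neighbourhoods *)

Section Exploration.
Variables (R : realType) (V : finType) (p : {set V} -> R).
Hypothesis p01 : forall e, 0 <= p e <= 1.
Local Notation prob := (prob p).
Local Notation expect := (expect p).

Definition touching (A : {set V}) : {set {set V}} :=
  [set e : {set V} | ~~ [disjoint e & A]].

Lemma touching2 (A : {set V}) u v :
  ([set u; v] \in touching A) = (u \in A) || (v \in A).
Proof.
rewrite inE; apply/pred0Pn/orP => /= [[w]|].
  by rewrite !inE => /andP[/orP[]/eqP-> wA]; [left|right].
by case=> wA; [exists u | exists v]; rewrite !inE eqxx wA ?orbT.
Qed.

Lemma touchingS (A B : {set V}) : A \subset B -> ~: touching B \subset ~: touching A.
Proof.
move=> AB; apply/subsetP => e; rewrite !inE !negbK => eB.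
exact: disjointWr AB eB.
Qed.

Definition nbr (E : {set {set V}}) (A U : {set V}) : {set V} :=
  [set v in ~: U | [exists u in A, [set u; v] \in E]].

Definition joins (A B : {set V}) : {set {set V}} :=
  [set [set u.1; u.2] | u in setX A B].

Lemma joinsP (A B : {set V}) u v : u \in A -> v \in B -> [set u; v] \in joins A B.
Proof. by move=> uA vB; apply/imsetP; exists (u, v) => //; rewrite inE uA. Qed.

Lemma disjointF (T : finType) (A B : {set T}) x :
  [disjoint A & B] -> x \in A -> x \in B -> False.
Proof. by move/pred0P/(_ x) => /= + xA xB; rewrite xA xB. Qed.

Lemma set2_inj_disjoint (A B : {set V}) : [disjoint A & B] ->
  {in setX A B &, injective (fun u : V * V => [set u.1; u.2])}.
Proof.
move=> dAB [u v] [u' v']; rewrite !inE /= => /andP[uA vB] /andP[u'A v'B] eq.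
have: u \in [set u'; v'] by rewrite -eq !inE eqxx.
have: v \in [set u'; v'] by rewrite -eq !inE eqxx orbT.
rewrite !inE => /orP[/eqP vu|/eqP ->] => [|/orP[/eqP ->//|/eqP uv]].
  by case: (disjointF dAB u'A); rewrite -vu.
by case: (disjointF dAB uA); rewrite uv.
Qed.

Lemma prob_no_join (A B : {set V}) (f : V -> V -> R) : [disjoint A & B] ->
  (forall u v, u \in A -> v \in B -> 1 - p [set u; v] <= expR (- f u v)) ->
  prob (fun E => [disjoint joins A B & E]) <=
  expR (- \sum_(u in A) \sum_(v in B) f u v).
Proof.
move=> dAB pf; rewrite prob_disjoint big_imset /=; last exact: set2_inj_disjoint.
rewrite -sumrN expR_sum.
rewrite (eq_bigl (fun u => (u.1 \in A) && (u.2 \in B))); last first.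
  by move=> u; rewrite inE.
rewrite -(pair_big (mem A) (mem B) (fun u v => 1 - p [set u; v])) /=.
apply: ler_prod => u uA; rewrite -sumrN expR_sum prodr_ge0 /=; last first.
  by move=> v _; rewrite subr_ge0; case/andP: (p01 [set u; v]).
apply: ler_prod => v vB; rewrite pf // andbT subr_ge0.
by case/andP: (p01 [set u; v]).
Qed.

Lemma mem_nbr (E : {set {set V}}) (A U : {set V}) v :
  reflect (v \notin U /\ exists2 u, u \in A & [set u; v] \in E) (v \in nbr E A U).
Proof.
rewrite !inE; apply: (iffP andP) => -[vU H]; split=> //.
  by case/existsP: H => u /andP[uA uv]; exists u.
by case: H => u uA uv; apply/existsP; exists u; rewrite uA.
Qed.

Lemma nbr_depends (A D U : {set V}) : D \subset U -> [disjoint A & D] ->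
  depends_on (touching A :\: touching D) (fun E => nbr E A U).
Proof.
move=> DU AD E F EF; apply/setP => v; rewrite !inE; case: (boolP (v \in U)) => //= vU.
apply: eq_existsb => u; case: (boolP (u \in A)) => //= uA.
apply: agree_mem EF; rewrite in_setD !touching2 uA andbT negb_or.
apply/andP; split; first by apply/negP; exact: disjointF AD uA.
exact: contra (subsetP DU v) vU.
Qed.

Lemma expRN_le_half (x : R) : 0 <= x <= 1 -> expR (- x) <= 1 - x / 2.
Proof.
move=> x01; rewrite expRN -[leLHS]mul1r ler_pdivrMr ?expR_gt0 //.
have := expR_ge1Dx x; nra.
Qed.

(** Growth of one layer. The vertices outside U are hit by disjoint sets of
    edges, so the mean of 2^-X, for X the number of new neighbours, is a product
    over these vertices, and Markov's inequality applies. The rates lam bound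
    the edge probabilities from below only, so they may neglect short edges;
    this is what makes eta small, so that the vertices already seen absorb at
    most 1 of the total rate Lam of each vertex of A. *)
Lemma prob_nbr_small (lam : V -> V -> R) (eta Lam : R) (A U : {set V}) (n : nat) :
  (forall u v, 0 <= lam u v <= eta) ->
  (forall u v, u != v -> 1 - p [set u; v] <= expR (- lam u v)) ->
  (forall u, Lam <= \sum_v lam u v) ->
  A \subset U -> #|U|%:R * eta <= 1 ->
  prob (fun E => #|nbr E A U| < n)%N <=
  2 ^+ n * expR (- (#|A|%:R * (Lam - 1) / 4)).
Proof.
move=> lam0 lamp lamL AU Ueta.
(* f v is the factor of 2^-X contributed by v, and J v the edges it depends on. *)
pose f v (E : {set {set V}}) : R :=
  if v \in U then 1 else if [exists u in A, [set u; v] \in E] then 2^-1 else 1.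
pose J v := if v \in U then set0 else joins A [set v].
have fprod E : 2^-1 ^+ #|nbr E A U| = \prod_(v <- enum V) f v E.
  rewrite -prodr_const big_enum_cond /= [LHS]big_mkcond.
  apply: eq_bigr => v _; rewrite /f; case: ifP => [|/negbT].
    case/mem_nbr => /negPf-> [u uA uv].
    by case: existsP => // -[]; exists u; rewrite uA.
  rewrite !inE; case: (v \in U) => //=; by case: ifP.
have hitJ v E : v \notin U ->
    [exists u in A, [set u; v] \in E] = ~~ [disjoint joins A [set v] & E].
  move=> vU; apply/existsP/pred0Pn => /= -[].
    by move=> u /andP[uA uv]; exists [set u; v]; rewrite uv joinsP ?inE.
  move=> e /andP[/imsetP[[u w]]]; rewrite !inE /= => /andP[uA /eqP->] -> eE.
  by exists u; rewrite uA.
have fJ v : depends_on (J v) (f v).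
  rewrite /f /J => E F; case: ifP => // /negbT vU EF.
  congr (if _ then _ else _); rewrite !hitJ // -!setI_eq0 -(setIid (joins _ _)).
  by rewrite -!setIA !(setIC (joins _ _)) EF.
have Jdis v w : v != w -> [disjoint J v & J w].
  rewrite /J => vw; case: ifPn => vU; first by rewrite -setI_eq0 set0I.
  case: ifPn => wU; first by rewrite disjoint_sym -setI_eq0 set0I.
  apply/pred0P => e /=; apply/negbTE/negP => /andP[].
  case/imsetP => -[u v'] /=; rewrite !inE /= => /andP[uA /eqP->] ->.
  case/imsetP => -[u' w'] /=; rewrite !inE /= => /andP[u'A /eqP->] eq.
  have: v \in [set u'; w] by rewrite -eq !inE eqxx orbT.
  rewrite !inE (negPf vw) orbF => /eqP vu'.
  by move: vU; rewrite vu' (subsetP AU).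
pose l v := \sum_(u in A) lam u v.
have l0 v : 0 <= l v by apply: sumr_ge0 => u _; case/andP: (lam0 u v).
have leta v : l v <= #|A|%:R * eta.
  rewrite mulr_natl -sumr_const; apply: ler_sum => u _.
  by case/andP: (lam0 u v).
have [->|/set0Pn[a aA]] := eqVneq A set0.
  rewrite cards0 mul0r mul0r oppr0 expR0 mulr1.
  by rewrite (le_trans (prob_le1 p01 _)) // exprn_ege1 ?ler1n.
have eta0 : 0 <= eta by case/andP: (lam0 a a) => h; apply: le_trans.
have l1 v : l v <= 1.
  rewrite (le_trans (leta v)) // (le_trans _ Ueta) // ler_wpM2r //.
  by rewrite ler_nat subset_leq_card.
have Ef v : v \notin U -> expect (f v) <= expR (- (l v / 4)).
  move=> vU; have dA : [disjoint A & [set v]].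
    rewrite disjoint_sym disjoints1; apply: contra vU; exact: (subsetP AU).
  have /(_ lam) := prob_no_join dA; move/(_ _) => H.
  have {}H : prob (fun E => [disjoint joins A [set v] & E]) <= expR (- l v).
    rewrite (le_trans (H _)) //.
      move=> u w uA /set1P ->; apply: lamp; apply: contraNneq vU => <-.
      exact: (subsetP AU).
    by rewrite ler_expR lerN2 /l; apply: ler_sum => u uA; rewrite big_set1.
  have -> : expect (f v) =
      2^-1 + 2^-1 * prob (fun E => [disjoint joins A [set v] & E]).
    rewrite -expectZ -[X in X + _](expect_cst p) -expectD; apply: eq_expect => E.
    rewrite /f (negPf vU) hitJ //; case: [disjoint _ & _] => /=; lra.
  have /expRN_le_half Hl : 0 <= l v <= 1 by rewrite l0 l1.
  apply: le_trans (expR_ge1Dx _).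
  have := le_trans H Hl; lra.
have Ef1 v : v \in U -> expect (f v) = 1.
  by move=> vU; rewrite -[RHS](expect_cst p); apply: eq_expect => E; rewrite /f vU.
have sum_l : #|A|%:R * (Lam - 1) <= \sum_(v in ~: U) l v.
  have : #|A|%:R * Lam <= \sum_v l v.
    rewrite exchange_big /= mulr_natl -sumr_const.
    by apply: ler_sum => u _; apply: lamL.
  rewrite (bigID [in U]) /= (eq_bigl [in ~: U] _ (fun v => esym (in_setC v U))).
  have : \sum_(v in U) l v <= #|A|%:R.
    apply: (@le_trans _ _ (\sum_(v in U) #|A|%:R * eta)).
      by apply: ler_sum => v _; apply: leta.
    rewrite sumr_const -[leLHS]mulr_natl mulrCA -[leRHS]mulr1.
    by rewrite ler_wpM2l.
  by rewrite mulrBr mulr1 => h1 h2; lra.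
have Hexp : expect (fun E => 2^-1 ^+ #|nbr E A U|) <=
            expR (- (#|A|%:R * (Lam - 1) / 4)).
  rewrite (eq_expect p fprod) (expect_prod p (enum_uniq V) fJ Jdis) big_enum_cond /=.
  rewrite (bigID [in U]) /= big1 ?mul1r; last by move=> v vU; apply: Ef1.
  apply: (@le_trans _ _ (\prod_(v in ~: U) expR (- (l v / 4)))).
    rewrite (eq_bigl [in ~: U]); last by move=> v; rewrite in_setC.
    apply: ler_prod => v; rewrite inE => vU; rewrite Ef // andbT.
    apply: expect_ge0 => // E; rewrite /f; do 2 case: ifP => //.
    by rewrite invr_ge0.
  rewrite -expR_sum ler_expR sumrN lerN2 -mulr_suml.
  by rewrite ler_wpM2r // invr_ge0.
rewrite -ler_pdivrMl ?exprn_gt0 // -exprVn.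
apply: le_trans Hexp; apply: prob_markov => // E.
  by rewrite exprn_ge0 // invr_ge0.
move=> small; apply: ler_wiXn2l; rewrite ?invr_ge0 ?invf_le1 ?ler1n //.
exact: ltnW.
Qed.

(** * Layered exploration *)

Definition subset_of_card (T : finType) (n : nat) (A : {set T}) : {set T} :=
  [set x in take n (enum A)].

Lemma subset_of_card_sub (T : finType) n (A : {set T}) : subset_of_card n A \subset A.
Proof. by apply/subsetP => x; rewrite inE => /mem_take; rewrite mem_enum. Qed.

Lemma card_subset_of_card (T : finType) n (A : {set T}) :
  (n <= #|A|)%N -> #|subset_of_card n A| = n.
Proof.
move=> nA; rewrite cardsE (card_uniqP _) ?take_uniq ?enum_uniq //.
by rewrite size_takel // -cardE.
Qed.

(** An event attached to the state (A, D, U) of an exploration: A is the current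
    layer, U the set of all vertices seen or to be avoided, and D the set of
    dead vertices, all of whose edges to new vertices have been inspected. *)
Definition stage := {set V} -> {set V} -> {set V} -> pred {set {set V}}.

(** Each layer is cut down to exactly m times the size of the previous one, so
    that the total number of vertices seen stays under control. The final event
    fin is a parameter so that explorations can be chained. *)
Fixpoint explore_fails (m k : nat) (fin : stage) : stage := fun A D U E =>
  if k is k'.+1 then
    let B := subset_of_card (m * #|A|) (nbr E A U) in
    (#|nbr E A U| < m * #|A|)%N || explore_fails m k' fin B (A :|: D) (U :|: B) E
  else fin A D U E.

(** W is a set of vertices put aside for a later stage: it is avoided, and no
    edge at W is inspected. *)
Definition valid_state (W A D U : {set V}) :=
  [&& A \subset U, D \subset U, W \subset U,
      [disjoint A & D], [disjoint A & W] & [disjoint D & W]].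

Lemma valid_state_sym W A D U : valid_state W A D U -> valid_state A W D U.
Proof.
by case/and5P => AU DU WU AD /andP[AW DW]; apply/and5P; split => //;
  rewrite 1?disjoint_sym ?AW //= disjoint_sym.
Qed.

Lemma disjoint_compl (A B U : {set V}) : B \subset ~: U -> A \subset U ->
  [disjoint B & A].
Proof.
by move=> BU AU; rewrite disjoints_subset (subset_trans BU) // setCS.
Qed.

Lemma valid_state_next (W A D U B : {set V}) : 
  valid_state W A D U -> B \subset ~: U ->
  valid_state W B (A :|: D) (U :|: B).
Proof.
case/and5P => AU DU WU AD /andP[AW DW] BU; apply/and5P; split.
- exact: subsetUr.
- by rewrite subUset !(subset_trans _ (subsetUl _ _)).
- by rewrite (subset_trans WU) // subsetUl.
- by rewrite (disjoint_compl BU) // subUset AU.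
- by rewrite (disjoint_compl BU) //= -setI_eq0 setIUl setU_eq0 !setI_eq0 AW.
Qed.

Lemma nbr_sub E (A U : {set V}) : nbr E A U \subset ~: U.
Proof. by apply/subsetP => v /mem_nbr[vU _]; rewrite inE. Qed.

(** The future of the exploration is decided by edges disjoint from the dead
    set, hence is independent of what has been inspected. *)
Definition forgets_dead (W : {set V}) (fin : stage) :=
  forall A D U, valid_state W A D U -> depends_on (~: touching D) (fin A D U).

Lemma explore_fails_forgets W m k fin :
  forgets_dead W fin -> forgets_dead W (explore_fails m k fin).
Proof.
move=> finW; elim: k => [//|k IH] A D U vs /= E F EF.
have [AU DU WU AD _] := and5P vs.
have -> : nbr E A U = nbr F A U.
  by apply: (nbr_depends DU AD); apply: agreeW EF; rewrite setDE subsetIr.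
congr (_ || _); apply: IH.
  apply: valid_state_next => //.
  exact: subset_trans (subset_of_card_sub _ _) (nbr_sub _ _ _).
exact: agreeW (touchingS (subsetUr A D)) EF.
Qed.

(** Union bound over the rounds. The set N of new neighbours of A is a function
    of the edges touching A, whereas the rest of the exploration depends on
    edges that do not touch A once N is given; the two factors separate after
    summing over N. *)
Lemma prob_explore_fails W m k fin (q r : R) (umax a : nat)
    (A D U : {set V}) :
  (0 < m)%N -> 0 <= q -> 0 <= r ->
  (forall A' U' : {set V}, A' \subset U' -> (a <= #|A'|)%N -> (#|U'| <= umax)%N ->
     prob (fun E => #|nbr E A' U'| < m * #|A'|)%N <= q) ->
  forgets_dead W fin ->
  (forall A' D' U' : {set V}, valid_state W A' D' U' -> #|A'| = (m ^ k * #|A|)%N ->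
     (#|U'| <= #|U| + \sum_(i < k) m ^ i.+1 * #|A|)%N ->
     prob (fin A' D' U') <= r) ->
  valid_state W A D U -> (a <= #|A|)%N ->
  (#|U| + \sum_(i < k) m ^ i.+1 * #|A| <= umax)%N ->
  prob (explore_fails m k fin A D U) <= k%:R * q + r.
Proof.
move=> m0 q0 r0 Hq finW; elim: k A D U => [|k IH] A D U Hr vs aA Uu.
  by rewrite mul0r add0r; apply: Hr; rewrite ?big_ord0 ?addn0 // mul1n.
have [AU DU WU AD _] := and5P vs.
pose B (N : {set V}) := subset_of_card (m * #|A|) N.
(* Failure in the later rounds when N is the set of new neighbours of A. *)
pose next (N : {set V}) (E : {set {set V}}) :=
  [&& (m * #|A| <= #|N|)%N, N \subset ~: U &
     explore_fails m k fin (B N) (A :|: D) (U :|: B N) E].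
apply: (@le_trans _ _ (q + (k%:R * q + r))); last first.
  by rewrite -natr1 mulrDl mul1r; lra.
have U1 : (#|U| <= umax)%N by apply: leq_trans Uu; rewrite leq_addr.
apply: (@le_trans _ _ (prob (fun E => #|nbr E A U| < m * #|A|)%N +
    prob (fun E => next (nbr E A U) E))).
  apply: le_trans (prob_or p01 _ _); apply: le_prob => // E /=.
  rewrite /next nbr_sub; by case: ltnP.
apply: lerD; first exact: Hq.
have -> : prob (fun E => next (nbr E A U) E) =
    expect (fun E => \sum_N (nbr E A U == N)%:R * (next N E)%:R).
  apply: eq_expect => E; rewrite (bigD1 (nbr E A U)) //= eqxx mul1r big1 ?addr0 //.
  by move=> N /negPf; rewrite eq_sym => ->; rewrite mul0r.
rewrite expect_sum.
have kqr : 0 <= k%:R * q + r by rewrite addr_ge0 // mulr_ge0.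
apply: (@le_trans _ _ (\sum_N prob (fun E => nbr E A U == N) * (k%:R * q + r))).
  apply: ler_sum => N _.
  have [/andP[mN NU]|Nbad] :=
      boolP ((m * #|A| <= #|N|)%N && (N \subset ~: U)); last first.
    rewrite (eq_expect p (g := fun=> 0)) ?expect_cst ?mulr_ge0 ?prob_ge0 //.
    by move=> E; rewrite /next andbA (negPf Nbad) mulr0.
  have BU : B N \subset ~: U by apply: subset_trans NU; apply: subset_of_card_sub.
  have vs' := valid_state_next vs BU.
  have next_eq : next N =1 explore_fails m k fin (B N) (A :|: D) (U :|: B N).
    by move=> E; rewrite /next mN NU.
  rewrite (expectM p (J := touching A)).
  - apply: ler_wpM2l; first exact: prob_ge0.
    have -> : expect (fun E => (next N E)%:R) =
        prob (explore_fails m k fin (B N) (A :|: D) (U :|: B N)).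
      by apply: eq_expect => E; rewrite next_eq.
    have cB : #|B N| = (m * #|A|)%N by rewrite card_subset_of_card.
    have sumE : (#|U :|: B N| + \sum_(i < k) m ^ i.+1 * #|B N| <=
        #|U| + \sum_(i < k.+1) m ^ i.+1 * #|A|)%N.
      rewrite big_ord_recl /= addnA expn1; apply: leq_add.
        by rewrite -cB cardsU leq_subr.
      apply: leq_sum => i _.
      by rewrite cB mulnA /bump /= add1n -expnSr.
    apply: IH => //.
    + move=> A' D' U' vs2 cA' cU'; apply: (Hr _ D') => //.
        by rewrite cA' cB mulnA -expnSr.
      exact: leq_trans sumE.
    + by rewrite cB (leq_trans aA) // leq_pmull.
    + exact: leq_trans sumE Uu.
  - move=> E F EF; congr (_ == _)%:R; apply: (nbr_depends DU AD).
    by apply: agreeW EF; rewrite setDE subsetIl.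
  - move=> E F EF; congr _%:R; rewrite !next_eq; congr nat_of_bool.
    apply: (explore_fails_forgets m k finW vs').
    exact: agreeW (touchingS (subsetUl A D)) EF.
rewrite -mulr_suml -expect_sum ler_piMl //.
rewrite -[leRHS](expect_cst p); apply: ler_expect => // E.
rewrite (bigD1 (nbr E A U)) //= eqxx big1 ?addr0 // => N /negPf.
by rewrite eq_sym => ->.
Qed.

Definition dist_le (E : {set {set V}}) (n : nat) (x y : V) :=
  exists s, [/\ path (adj E) x s, last x s = y & (size s <= n)%N].

Lemma dist_le_refl E n x : dist_le E n x x.
Proof. by exists [::]. Qed.

Lemma dist_le_trans E n n' x y z :
  dist_le E n x y -> dist_le E n' y z -> dist_le E (n + n') x z.
Proof.
move=> [s [sp sl ss]] [t [tp tl ts]]; exists (s ++ t); split.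
- by rewrite cat_path sp sl.
- by rewrite last_cat sl.
- by rewrite size_cat leq_add.
Qed.

Lemma dist_le_edge (E : {set {set V}}) x y :
  x != y -> [set x; y] \in E -> dist_le E 1 x y.
Proof. by move=> xy xyE; exists [:: y]; split; rewrite //= /adj xy xyE. Qed.

Lemma dist_leW E n n' x y : (n <= n')%N -> dist_le E n x y -> dist_le E n' x y.
Proof. by move=> nn [s [sp sl ss]]; exists s; split=> //; apply: leq_trans nn. Qed.

Lemma dist_le_sym E n x y : dist_le E n x y -> dist_le E n y x.
Proof.
move=> [s [sp sl ss]]; exists (rev (belast x s)); split.
- rewrite -sl rev_path (eq_path (e' := adj E)) // => u v.
  by rewrite /adj eq_sym setUC.
- by case: s {sp ss} sl => [|v s] //= _; rewrite rev_cons last_rcons.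
- by rewrite size_rev size_belast.
Qed.

Lemma explore_succeeds m k fin (A D U : {set V}) E : A \subset U ->
  ~~ explore_fails m k fin A D U E ->
  exists A' D' U', ~~ fin A' D' U' E /\ U \subset U' /\
    forall v, v \in A' -> exists2 u, u \in A & dist_le E k u v.
Proof.
elim: k A D U => [|k IH] A D U AU /=.
  move=> nf; exists A, D, U; do 2!split => //; move=> v vA.
  by exists v => //; apply: dist_le_refl.
rewrite negb_or; set B := subset_of_card _ _ => /andP[_].
case/IH => [|A' [D' [U' [nf [UU H]]]]]; first exact: subsetUr.
exists A', D', U'; split => //; split=> [|v /H[u uB wuv]].
  exact: subset_trans (subsetUl _ _) UU.
have := subsetP (subset_of_card_sub _ _) _ uB; case/mem_nbr => uU [w wA wu].
exists w => //; rewrite -add1n; apply: dist_le_trans wuv; apply: dist_le_edge => //.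
by apply: contraNneq uU => <-; apply: (subsetP AU).
Qed.

(** * Meeting of two explorations *)

Definition no_join (A : {set V}) : stage := fun B _ _ E => [disjoint joins A B & E].

(** An exploration from A that avoids B, followed by one from B that avoids all
    that was seen from A, followed by a test for an edge between the two last
    layers. The last layer A' of the first exploration is the set put aside
    during the second one. *)
Definition meet_fails (m k : nat) (A B : {set V}) : pred {set {set V}} :=
  explore_fails m k
    (fun A' D U => explore_fails m k (no_join A') B D U) A set0 (A :|: B).

Lemma no_join_forgets A : forgets_dead A (no_join A).
Proof.
move=> B D U /and5P[BU DU AU BD /andP[BA DA]] E F EF.
rewrite /no_join -!setI_eq0.
have sub : joins A B \subset ~: touching D.
  apply/subsetP => e /imsetP[[u v]]; rewrite inE /= => /andP[uA vB] ->.
  rewrite inE touching2; apply/norP; split; apply/negP.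
    by move/(disjointF DA)/(_ uA).
  exact: disjointF BD vB.
have joinT (X : {set {set V}}) :
    joins A B :&: X = joins A B :&: (X :&: ~: touching D).
  by rewrite [RHS]setICA (setIidPl sub) setIC.
by rewrite joinT EF -joinT.
Qed.

Lemma prob_meet_fails m k (q r : R) (umax a : nat) (A B : {set V}) :
  (0 < m)%N -> 0 <= q -> 0 <= r ->
  (forall A' U' : {set V}, A' \subset U' -> (a <= #|A'|)%N -> (#|U'| <= umax)%N ->
     prob (fun E => #|nbr E A' U'| < m * #|A'|)%N <= q) ->
  (forall A' B' : {set V}, [disjoint A' & B'] ->
     #|A'| = (m ^ k * a)%N -> #|B'| = (m ^ k * a)%N ->
     prob (fun E => [disjoint joins A' B' & E]) <= r) ->
  #|A| = a -> #|B| = a -> [disjoint A & B] ->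
  (2 * (a + \sum_(i < k) m ^ i.+1 * a) <= umax)%N ->
  prob (meet_fails m k A B) <= (2 * k)%:R * q + r.
Proof.
move=> m0 q0 r0 Hq Hr cA cB AB Uu.
have kq0 : 0 <= k%:R * q + r by rewrite addr_ge0 // mulr_ge0.
have -> : (2 * k)%:R * q + r = k%:R * q + (k%:R * q + r) by rewrite natrM; lra.
have cAB : (#|A :|: B| <= 2 * a)%N.
  by rewrite mul2n -addnn (leq_trans (leq_card_setU A B)) // cA cB.
rewrite mulnDr in Uu.
apply: (@prob_explore_fails B m k _ q _ umax a) => //.
- move=> A' D U /valid_state_sym.
  exact: explore_fails_forgets (@no_join_forgets A') _ _ _.
- rewrite cA => A' D U vs cA' cU.
  apply: (@prob_explore_fails A' m k _ q _ umax a) => //.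
  + exact: no_join_forgets.
  + rewrite cB => B' D' U' /and5P[_ _ _ _ /andP[BA _]] cB' _.
    by apply: Hr => //; rewrite disjoint_sym.
  + exact: valid_state_sym.
  + by rewrite cB.
  + rewrite cB; apply: leq_trans Uu.
    rewrite [(2 * \sum_(i < k) _)%N]mul2n -addnn addnA.
    rewrite leq_add2r (leq_trans cU) // leq_add2r //.
- apply/and5P; split; rewrite ?sub0set ?subsetUl ?subsetUr //.
    by rewrite disjoint_sym -setI_eq0 set0I.
  by rewrite AB -setI_eq0 set0I eqxx.
- by rewrite cA.
- rewrite cA; apply: leq_trans Uu; apply: leq_add => //.
  by rewrite leq_pmull.
Qed.

Lemma meet_succeeds m k (A B : {set V}) E : [disjoint A & B] ->
  ~~ meet_fails m k A B E ->
  exists u v, [/\ u \in A, v \in B & dist_le E (2 * k + 1) u v].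
Proof.
move=> AB; case/explore_succeeds; first exact: subsetUl.
move=> A' [D [U [+ [/(subset_trans (subsetUr A B)) BU HA]]]].
case/explore_succeeds => // B' [D' [U' [+ [_ HB]]]].
case/pred0Pn => e /= /andP[/imsetP[[u' v']]].
rewrite !inE /= => /andP[/HA[u uA wu] /HB[v vB wv]] -> uvE.
exists u, v; split => //; rewrite mul2n -addnn -addnA (addnC k 1%N).
apply: (dist_le_trans wu); apply: dist_le_trans (dist_le_sym wv).
have [->|uv] := eqVneq u' v'; last exact: dist_le_edge.
exact: dist_le_refl.
Qed.

End Exploration.

(** * Self-avoiding walks *)

Section SelfAvoidingWalks.
Variables (R : realType) (V : finType) (p : {set V} -> R).
Hypothesis p01 : forall e, 0 <= p e <= 1.
Local Notation prob := (prob p).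

(** A walk of length n from x to y that never returns to a visited vertex nor
    enters U. *)
Fixpoint saw (E : {set {set V}}) (n : nat) (U : {set V}) (x y : V) : bool :=
  if n is n'.+1 then
    [exists v, [&& v \notin x |: U, [set x; v] \in E & saw E n' (x |: U) v y]]
  else x == y.

Lemma saw_depends n (U : {set V}) x y : x \notin U ->
  depends_on (~: touching U) (fun E => saw E n U x y).
Proof.
elim: n U x => [|n IH] U x xU E F EF //=.
apply: eq_existsb => v; case: (boolP (v \in x |: U)) => //= vxU; congr (_ && _).
  apply: agree_mem EF; rewrite inE touching2 negb_or xU /=.
  by apply: contra vxU; apply/subsetP/subsetUr.
exact: (IH _ _ vxU) (agreeW (touchingS (subsetUr [set x] U)) EF).
Qed.

(** The first edge of the walk contains x and the remaining ones do not, so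
    each step costs a factor Delta, the maximal mean degree. *)
Lemma sum_prob_saw (Delta : R) n (U : {set V}) x :
  (forall u, \sum_(v | v != u) p [set u; v] <= Delta) -> x \notin U ->
  \sum_y prob (fun E => saw E n U x y) <= Delta ^+ n.
Proof.
move=> degD; elim: n U x => [|n IH] U x xU /=.
  rewrite expr0 (bigD1 x) //= big1 => [|y /negPf yx].
    by rewrite addr0; apply: prob_le1.
  by rewrite prob_eq0 // => E; rewrite eq_sym yx.
have D0 : 0 <= Delta.
  by apply: le_trans (degD x); apply: sumr_ge0 => v _; case/andP: (p01 [set x; v]).
pose step y v (E : {set {set V}}) :=
  [&& v \notin x |: U, [set x; v] \in E & saw E n (x |: U) v y].
apply: (@le_trans _ _ (\sum_v \sum_y prob (step y v))).
  rewrite [leRHS]exchange_big /=; apply: ler_sum => y _.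
  exact: prob_exists.
apply: (@le_trans _ _ (\sum_(v | v != x) p [set x; v] * Delta ^+ n)); last first.
  by rewrite -mulr_suml exprS ler_wpM2r ?exprn_ge0.
rewrite [leRHS]big_mkcond; apply: ler_sum => v _.
have [vxU|vxU] := boolP (v \in x |: U).
  rewrite big1 => [|y _].
    by case: ifP => // _; rewrite mulr_ge0 ?exprn_ge0 //; case/andP: (p01 [set x; v]).
  by rewrite prob_eq0 // => E; rewrite /step vxU.
have -> : v != x by apply: contra vxU => /eqP->; rewrite !inE eqxx.
apply: le_trans (ler_wpM2l _ (IH _ _ vxU)); last by case/andP: (p01 [set x; v]).
rewrite mulr_sumr; apply: ler_sum => y _.
rewrite -[p _]prob_mem -(@expectM _ _ _ (touching [set x])).
- apply: ler_expect => // E; rewrite /step vxU /=.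
  by case: (_ \in E); rewrite ?mul0r ?mul1r.
- move=> E F EF; congr _%:R; congr nat_of_bool.
  by apply: agree_mem EF; rewrite touching2 inE eqxx.
- move=> E F EF; congr _%:R; congr nat_of_bool; apply: (saw_depends n y vxU).
  exact: agreeW (touchingS (subsetUl [set x] U)) EF.
Qed.

Lemma path_saw (E : {set {set V}}) (U : {set V}) x s :
  path (adj E) x s -> uniq (x :: s) ->
  {in x :: s, forall v, v \notin U} -> saw E (size s) U x (last x s).
Proof.
elim: s U x => [|v s IH] U x //= /andP[/andP[xv xvE] ps] /andP[xs us] sU.
apply/existsP; exists v.
have vxU w : w \in v :: s -> w \notin x |: U.
  move=> ws; rewrite !inE negb_or; apply/andP; split.
    by apply: contraNneq xs => <-.
  by apply: sU; rewrite inE ws orbT.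
by rewrite vxU ?inE ?eqxx //= xvE IH.
Qed.

Lemma dist_le_saw (E : {set {set V}}) n x y :
  dist_le E n x y -> exists j : 'I_n.+1, saw E j set0 x y.
Proof.
move=> [s [sp sl ss]]; case/shortenP: sp sl => t pt ut ts sl.
have tn : (size t < n.+1)%N.
  rewrite ltnS (leq_trans _ ss) // uniq_leq_size //; first by case/andP: ut.
exists (Ordinal tn) => /=; rewrite -sl path_saw // => v _.
by rewrite inE.
Qed.

(** On Q each vertex is the end of one of the walks counted on the right. *)
Lemma prob_all_dist_le (Delta : R) n x (Q : pred {set {set V}}) :
  (forall u, \sum_(v | v != u) p [set u; v] <= Delta) ->
  (forall E, Q E -> forall y, dist_le E n x y) ->
  #|V|%:R * prob Q <= \sum_(j < n.+1) Delta ^+ j.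
Proof.
move=> degD Qn.
apply: (@le_trans _ _ (\sum_(j < n.+1) \sum_y prob (fun E => saw E j set0 x y))).
  rewrite exchange_big /= -sum1_card natr_sum mulr_suml; apply: ler_sum => y _.
  rewrite mul1r; apply: le_trans (prob_exists _ _) => //.
  apply: le_prob => // E /Qn/(_ y)/dist_le_saw[j jy].
  by apply/existsP; exists j.
by apply: ler_sum => j _; apply: sum_prob_saw => //; rewrite inE.
Qed.

End SelfAvoidingWalks.

(** * Counting in the box *)

(** Near an end of 0, ..., N only one side of s is available; 2 j <= N + 1
    ensures that one of the two sides has room for j points. *)
Lemma card_near_ge (N s j : nat) : (2 * j <= N.+1)%N -> (s < N.+1)%N ->
  (j <= #|[pred t : 'I_N.+1 | `|t%:Z - s%:Z| < j]|)%N.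
Proof.
move=> jN sN; pose f (i : 'I_j) : 'I_N.+1 :=
  if (j <= s.+1)%N then inord (s - i) else inord (s + i).
have fE (i : 'I_j) :
    nat_of_ord (f i) = if (j <= s.+1)%N then (s - i)%N else (s + i)%N.
  have := ltn_ord i; rewrite /f => ij; case: ifP => h; rewrite inordK //; lia.
have f_inj : injective f.
  move=> i i' /(congr1 (@nat_of_ord _)); rewrite !fE => e; apply: val_inj => /=.
  by have := ltn_ord i; have := ltn_ord i'; move: e; case: ifP => h; lia.
rewrite -[X in (X <= _)%N](card_ord j) -(card_image f_inj).
apply: subset_leq_card; apply/subsetP => t /imageP[i _ ->].
by rewrite inE fE; have := ltn_ord i; case: ifP => h; lia.
Qed.

Lemma card_near_le (N s j : nat) :
  (#|[pred t : 'I_N.+1 | (`|t%:Z - s%:Z| <= j)%N]| <= 2 * j + 1)%N.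
Proof.
rewrite -[X in (_ <= X)%N]card_ord addn1.
apply: (@leq_card_in _ _ (fun t : 'I_N.+1 => inord (t + j - s) : 'I_(2 * j).+1)).
move=> t t'; rewrite !inE => ht ht' /(congr1 (@nat_of_ord _)).
by rewrite !inordK; try lia; move=> e; apply: val_inj => /=; lia.
Qed.

Lemma card_at_le (N s j : nat) :
  (#|[pred t : 'I_N.+1 | `|t%:Z - s%:Z| == j]| <= 2)%N.
Proof.
apply: (@leq_trans #|[set (inord (s - j) : 'I_N.+1); inord (s + j)]|).
  apply: subset_leq_card; apply/subsetP => t; rewrite !inE => /eqP ht.
  have := ltn_ord t => tN.
  have [ts|ts] := leqP t s; apply/orP; [left|right]; apply/eqP; apply: val_inj;
    rewrite /= inordK; lia.
by rewrite cards2; case: (_ != _).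
Qed.

Lemma card_at_ge (N s j : nat) : (2 * j <= N.+1)%N -> (s < N.+1)%N ->
  (0 < #|[pred t : 'I_N.+1 | `|t%:Z - s%:Z| == j]|)%N.
Proof.
move=> jN sN; apply/card_gt0P.
exists (if (j <= s)%N then inord (s - j) else inord (s + j)).
by rewrite inE; case: ifP => h; rewrite inordK; lia.
Qed.

Lemma card_family_prod (aT rT : finType) (F : aT -> pred rT) :
  #|[pred f : {ffun aT -> rT} | f \in family F]| = (\prod_i #|F i|)%N.
Proof.
rewrite -[LHS]/(#|family F|) card_family foldrE big_map big_enum //.
Qed.

Section Box.
Variables (d N : nat).
Hypothesis hd : (0 < d)%N.
Local Notation site := (site d N).

(** Points whose displacement from u is exactly j in coordinate i0 and bounded
    through c in the others. The strict version [cone] gives disjoint sets as j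
    varies, for lower bounds; the faces [face], as i0 and j vary, cover the box
    without u, for upper bounds. *)
Definition shell (c : rel nat) (i0 : 'I_d) (u : site) (j : nat) : pred site :=
  [pred v : site | (`|(v i0)%:Z - (u i0)%:Z| == j)%N &&
     [forall i, (i != i0) ==> c `|(v i)%:Z - (u i)%:Z|%N j]].

Definition cone := shell ltn.

Definition face := shell leq.

Lemma card_shell c i0 u j : #|shell c i0 u j| =
  (#|[pred t : 'I_N.+1 | `|t%:Z - (u i0)%:Z| == j]| *
   \prod_(i | i != i0) #|[pred t : 'I_N.+1 | c `|t%:Z - (u i)%:Z|%N j]|)%N.
Proof.
pose F i := [pred t : 'I_N.+1 | if i == i0 then (`|t%:Z - (u i)%:Z| == j)%N
  else c `|t%:Z - (u i)%:Z|%N j].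
rewrite (eq_card (B := [pred v : site | v \in family F])); last first.
  move=> v; rewrite !inE; apply/andP/familyP => [[/eqP v0 /forallP vi] i|vF].
    by rewrite inE; case: eqVneq => [->|ii0]; [apply/eqP|exact: (implyP (vi i))].
  have := vF i0; rewrite inE eqxx => ->; split=> //.
  apply/forallP => i; apply/implyP => ii0.
  by have := vF i; rewrite inE (negPf ii0).
rewrite card_family_prod (bigD1 i0) //=; congr (_ * _)%N.
  by apply: eq_card => t; rewrite !inE eqxx.
by apply: eq_bigr => i ii0; apply: eq_card => t; rewrite !inE (negPf ii0).
Qed.

Lemma prod_neq_const (i0 : 'I_d) n : (\prod_(i | i != i0) n = n ^ d.-1)%N.
Proof. by rewrite prod_nat_const cardC1 card_ord. Qed.

Lemma card_cone i0 u j : (2 * j <= N.+1)%N -> (j ^ d.-1 <= #|cone i0 u j|)%N.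
Proof.
move=> jN; rewrite card_shell -(prod_neq_const i0) -[leqLHS]mul1n.
apply: leq_mul; first exact: card_at_ge jN (ltn_ord (u i0)).
by apply: leq_prod => i _; apply: card_near_ge jN (ltn_ord (u i)).
Qed.

Lemma card_face i0 u j : (#|face i0 u j| <= 2 * (2 * j + 1) ^ d.-1)%N.
Proof.
rewrite card_shell -(prod_neq_const i0); apply: leq_mul; first exact: card_at_le.
by apply: leq_prod => i _; apply: card_near_le.
Qed.

Lemma l1distC (x y : site) : l1dist x y = l1dist y x.
Proof. by apply: eq_bigr => i _; rewrite distnC. Qed.

Lemma l1dist_coord (x y : site) i : (`|(x i)%:Z - (y i)%:Z| <= l1dist x y)%N.
Proof. by rewrite /l1dist (bigD1 i) //= leq_addr. Qed.

Lemma l1dist_le (x y : site) j :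
  (forall i, `|(x i)%:Z - (y i)%:Z| <= j)%N -> (l1dist x y <= d * j)%N.
Proof.
move=> xy; rewrite -[X in (X * j)%N](card_ord d) -sum_nat_const.
by apply: leq_sum => i _.
Qed.

Lemma l1dist_le_diam (x y : site) : (l1dist x y <= d * N)%N.
Proof.
by apply: l1dist_le => i; have := ltn_ord (x i); have := ltn_ord (y i); lia.
Qed.

Lemma l1dist_gt0 (x y : site) : x != y -> (0 < l1dist x y)%N.
Proof.
move=> xy; have [i xyi] : exists i, x i != y i.
  apply/existsP; apply: contraR xy; rewrite negb_exists => /forallP H.
  by apply/eqP/ffunP => i; apply/eqP; rewrite -[_ == _]negbK.
apply: leq_trans (l1dist_coord x y i); rewrite absz_gt0 subr_eq0.
by apply: contra xyi => /eqP[] /val_inj ->.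
Qed.

Lemma cone_l1dist i0 u v j : v \in cone i0 u j -> (j <= l1dist u v <= d * j)%N.
Proof.
rewrite inE => /andP[/eqP vj /forallP H]; apply/andP; split.
  by rewrite l1distC -[leqLHS]vj l1dist_coord.
rewrite l1distC; apply: l1dist_le => i.
have [->|ii0] := eqVneq i i0; first by rewrite vj.
by apply: ltnW; exact: (implyP (H i)).
Qed.

(** The coordinate i0 realizes the sup-norm of v - u. *)
Lemma face_exists u v : u != v ->
  exists2 j : 'I_N.+1, (0 < j)%N &
    exists2 i0, v \in face i0 u j & (j <= l1dist u v)%N.
Proof.
move=> uv; pose f (i : 'I_d) := `|(v i)%:Z - (u i)%:Z|%N.
have fN i : (f i < N.+1)%N.
  by rewrite /f; have := ltn_ord (u i); have := ltn_ord (v i); lia.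
case: (@arg_maxnP _ (Ordinal hd) xpredT f isT) => i0 _ fmax.
have j0 : (0 < f i0)%N.
  rewrite lt0n; apply: contraL (l1dist_gt0 uv) => /eqP f0; rewrite -leqNgt l1distC.
  rewrite -(muln0 d); apply: l1dist_le => i; rewrite -[X in (_ <= X)%N]f0.
  exact: fmax.
exists (Ordinal (fN i0)) => //=; exists i0; last by rewrite l1distC l1dist_coord.
rewrite inE eqxx /=; apply/forallP => i; apply/implyP => _; exact: fmax.
Qed.

End Box.

(** * Edge probabilities in the box *)

Lemma ln_le_harmonic (R : realType) (r n : nat) : (0 < r)%N -> (r <= n)%N ->
  ln (n%:R / r%:R : R) <= \sum_(r <= j < n) j%:R^-1.
Proof.
move=> r0; elim: n => [|n IH]; first by rewrite leqn0 => /eqP r00; rewrite r00 in r0.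
rewrite leq_eqVlt => /predU1P[->|].
  by rewrite big_geq // divff ?ln1 // pnatr_eq0.
rewrite ltnS => rn; rewrite big_nat_recr //=.
have n0 : (0 < n)%N by apply: leq_trans rn.
have nR : 0 < n%:R :> R by rewrite ltr0n.
have rR : 0 < r%:R :> R by rewrite ltr0n.
have -> : n.+1%:R / r%:R = n%:R / r%:R * (1 + n%:R^-1) :> R.
  by rewrite -natr1; field; rewrite !gt_eqF.
have in0 : 0 < n%:R^-1 :> R by rewrite invr_gt0.
rewrite lnM ?posrE ?divr_gt0 ?addr_gt0 //.
by apply: lerD; [exact: IH | apply: le_ln1Dx; lra].
Qed.

Lemma harmonic_le_ln (R : realType) (n : nat) : (0 < n)%N ->
  \sum_(1 <= j < n.+1) j%:R^-1 <= 1 + ln n%:R :> R.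
Proof.
case: n => // n _; elim: n => [|n IH].
  by rewrite big_nat1 ln1 invr1 addr0.
rewrite big_nat_recr //=; apply: le_trans (lerD IH (lexx _)) _.
have n1 : 0 < n.+1%:R :> R by rewrite ltr0n.
have n2 : 0 < n.+2%:R :> R by rewrite ltr0n.
have -> : n.+1%:R = n.+2%:R * (1 - n.+2%:R^-1) :> R.
  by rewrite mulrBr mulr1 divff ?gt_eqF // -[n.+2%:R]natr1 addrK.
have i2 : n.+2%:R^-1 < 1 :> R by rewrite invf_lt1 // ltr1n.
rewrite lnM ?posrE ?subr_gt0 //.
have /(@le_ln1Dx R) : -1 < - n.+2%:R^-1 :> R by rewrite ltrN2.
by rewrite -addrA lerD2l -addrA gerDl -lerBrDr sub0r.
Qed.

Section BoxProbabilities.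
Variables (R : realType) (d N : nat) (beta : R).
Hypothesis hd : (0 < d)%N.
Hypothesis hbeta : 0 < beta.
Local Notation site := (site d N).

Lemma edge_prob_compl (u v : site) :
  1 - edge_prob beta u v <= expR (- (beta / (l1dist u v)%:R ^+ d)).
Proof.
by rewrite /edge_prob; case: ifP => _; rewrite ?subrr ?expR_ge0 // opprB addrC subrK.
Qed.

Lemma edge_prob_le (u v : site) : u != v ->
  edge_prob beta u v <= (1 + beta) / (l1dist u v)%:R ^+ d.
Proof.
move=> uv; rewrite /edge_prob; case: eqP => [->|_].
  by rewrite expr1n divr1 lerDl ltW.
have l0 : 0 < (l1dist u v)%:R ^+ d :> R by rewrite exprn_gt0 // ltr0n l1dist_gt0.
have := expR_ge1Dx (- (beta / (l1dist u v)%:R ^+ d)).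
have : 0 < ((l1dist u v)%:R ^+ d)^-1 :> R by rewrite invr_gt0.
by rewrite mulrDl mul1r; lra.
Qed.

(** The rate of the edge between u and v, with edges shorter than r
    neglected. *)
Definition long_rate (r : nat) (u v : site) : R :=
  if (r <= l1dist u v)%N then beta / (l1dist u v)%:R ^+ d else 0.

Lemma long_rate_bounds r (u v : site) : (0 < r)%N ->
  0 <= long_rate r u v <= beta / r%:R ^+ d.
Proof.
move=> r0; rewrite /long_rate; case: ifP => [rl|_].
  have l0 : (0 < l1dist u v)%N by apply: leq_trans rl.
  rewrite divr_ge0 ?exprn_ge0 ?(ltW hbeta) //= ler_pM2l //.
  rewrite lef_pV2 ?posrE ?exprn_gt0 ?ltr0n //.
  by rewrite lerXn2r ?nnegrE ?ler_nat ?ler0n.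
by rewrite lexx divr_ge0 ?exprn_ge0 ?(ltW hbeta).
Qed.

Lemma edge_prob_compl_long r (u v : site) :
  1 - edge_prob beta u v <= expR (- long_rate r u v).
Proof.
rewrite (le_trans (edge_prob_compl u v)) // ler_expR lerN2 /long_rate.
by case: ifP => // _; rewrite divr_ge0 ?exprn_ge0 ?(ltW hbeta).
Qed.

(** The cone at displacement j has at least j^(d-1) points, all at distance
    between j and d j, so it contributes at least beta / d^d / j; the harmonic
    sum over r <= j < n gives the logarithm. *)
Lemma sum_long_rate_ge r n (u : site) : (0 < r)%N -> (r <= n)%N ->
  (2 * n <= N.+3)%N ->
  beta / d%:R ^+ d * ln (n%:R / r%:R) <= \sum_v long_rate r u v.
Proof.
move=> r0 rn nN; pose i0 := Ordinal hd.
have c0 : 0 < beta / d%:R ^+ d by rewrite divr_gt0 // exprn_gt0 // ltr0n.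
apply: le_trans (ler_wpM2l (ltW c0) (ln_le_harmonic R r0 rn)) _.
have lr0 v : 0 <= long_rate r u v by case/andP: (long_rate_bounds u v r0).
apply: (@le_trans _ _ (\sum_(r <= j < n) \sum_(v in cone i0 u j) long_rate r u v)).
  rewrite mulr_sumr big_nat_cond [leRHS]big_nat_cond; apply: ler_sum => j.
  rewrite andbT => /andP[rj jn].
  have j0 : (0 < j)%N by apply: leq_trans rj.
  have jR : 0 < j%:R :> R by rewrite ltr0n.
  have dR : 0 < d%:R :> R by rewrite ltr0n.
  have jN : (2 * j <= N.+1)%N by lia.
  apply: (@le_trans _ _ (\sum_(v in cone i0 u j) beta / (d * j)%:R ^+ d)).
    rewrite sumr_const -[leRHS]mulr_natl.
    apply: (@le_trans _ _ ((j ^ d.-1)%:R * (beta / (d * j)%:R ^+ d))); last first.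
      rewrite ler_wpM2r ?divr_ge0 ?exprn_ge0 ?(ltW hbeta) // ler_nat.
      exact: card_cone.
    rewrite natrM exprMn natrX -[in X in _ <= _ * (_ / (_ * X))](prednK hd) exprSr.
    by rewrite le_eqVlt; apply/orP; left; apply/eqP; field;
       rewrite !expf_neq0 ?gt_eqF.
  apply: ler_sum => v /cone_l1dist /andP[jl ldj].
  rewrite /long_rate (leq_trans rj jl) ler_pM2l //.
  rewrite lef_pV2 ?posrE ?exprn_gt0 ?ltr0n ?muln_gt0 ?hd ?(leq_trans j0) //.
  by rewrite lerXn2r ?nnegrE ?ler_nat ?ler0n.
under eq_bigr do rewrite big_mkcond.
rewrite exchange_big /=; apply: ler_sum => v _.
rewrite -big_mkcond /= -big_filter.
(* Each v lies in the cone of at most one displacement j. *)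
set s := [seq _ <- _ | _].
have : (size s <= 1)%N.
  apply: (@leq_trans (size [:: `|(v i0)%:Z - (u i0)%:Z|%N])) => //.
  apply: uniq_leq_size; first by rewrite filter_uniq // iota_uniq.
  by move=> j; rewrite mem_filter !inE => /andP[/andP[/eqP <-]].
by case: s => [|j [|//]] _; rewrite ?big_nil ?big_seq1.
Qed.

(** The d faces at displacement j have at most 2 (3 j)^(d-1) points each, all at
    distance at least j, so together they contribute a multiple of 1 / j. *)
Lemma sum_edge_prob_le (u : site) : (0 < N)%N ->
  \sum_(v | v != u) edge_prob beta u v <=
  (1 + beta) * (d * 2 * 3 ^ d.-1)%:R * (1 + ln N%:R).
Proof.
move=> N0.
apply: (@le_trans _ _ (\sum_(v | v != u) (1 + beta) * ((l1dist u v)%:R ^+ d)^-1)).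
  by apply: ler_sum => v vu; apply: edge_prob_le; rewrite eq_sym.
rewrite -mulr_sumr -mulrA ler_wpM2l //; first by have := hbeta; lra.
apply: le_trans (ler_wpM2l (ler0n _ _) (harmonic_le_ln R N0)).
apply: (@le_trans _ _
  (\sum_(1 <= j < N.+1) \sum_(i0 < d) \sum_(v in face i0 u j) (j%:R ^+ d)^-1)).
  rewrite big_add1 /= big_mkord.
  rewrite [leLHS](_ : _ = \sum_(v | v != u) ((l1dist u v)%:R ^+ d)^-1) //.
  under [leRHS]eq_bigr => j _ do under eq_bigr => i0 _ do rewrite big_mkcond.
  under [leRHS]eq_bigr => j _ do rewrite exchange_big.
  rewrite /= [leRHS]exchange_big /= big_mkcond; apply: ler_sum => v _.
  have F0 (j : 'I_N) (i0 : 'I_d) :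
      0 <= (if v \in face i0 u j.+1 then (j.+1%:R ^+ d)^-1 else 0) :> R.
    by case: ifP => // _; rewrite invr_ge0 exprn_ge0.
  case: ifPn => vu; last by apply: sumr_ge0 => j _; apply: sumr_ge0 => i0 _.
  have uv : u != v by rewrite eq_sym.
  have [[[//|j] jN] /= _ [i0 vf jl]] := face_exists hd uv.
  rewrite (bigD1 (Ordinal (jN : (j < N)%N))) //= (bigD1 i0) //= vf -addrA.
  apply: (@le_trans _ _ (j.+1%:R ^+ d)^-1).
    rewrite lef_pV2 ?posrE ?exprn_gt0 ?ltr0n ?(leq_trans _ jl) //.
    by rewrite lerXn2r ?nnegrE ?ler_nat ?ler0n.
  rewrite lerDl; apply: addr_ge0; apply: sumr_ge0 => // j' _.
    exact: (F0 (Ordinal (jN : (j < N)%N))).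
  by apply: sumr_ge0 => i _; exact: F0.
rewrite mulr_sumr big_nat_cond [leRHS]big_nat_cond; apply: ler_sum => j.
rewrite andbT => /andP[j0 _].
have jR : 0 < j%:R :> R by rewrite ltr0n.
apply: (@le_trans _ _ (\sum_(i0 < d) (2 * 3 ^ d.-1)%:R * j%:R^-1)); last first.
  by rewrite sumr_const card_ord -[leLHS]mulr_natl mulrA -natrM mulnA.
apply: ler_sum => i0 _; rewrite sumr_const -[leLHS]mulr_natl.
rewrite ler_pdivrMr ?exprn_gt0 // -mulrA -[in X in _ * (_ * X)](prednK hd).
rewrite exprS mulKf ?gt_eqF //.
rewrite -natrX -natrM ler_nat -mulnA -expnMn.
apply: leq_trans (card_face i0 u j) _; rewrite leq_mul2l /=.
by case: d.-1 => [|k]; rewrite ?expn0 ?leq_exp2r //; lia.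
Qed.

End BoxProbabilities.

(** * Nearest-neighbour paths *)

Section NearestNeighbours.
Variables (d N : nat).
Local Notation site := (site d N).

Definition move_coord (x : site) (i : 'I_d) (t : 'I_N.+1) : site :=
  [ffun j => if j == i then t else x j].

Lemma l1dist_move_coord x y i t :
  (l1dist (move_coord x i t) y + `|(x i)%:Z - (y i)%:Z| =
   l1dist x y + `|t%:Z - (y i)%:Z|)%N.
Proof.
rewrite /l1dist (bigD1 i) //= [in RHS](bigD1 i) //= ffunE eqxx.
rewrite (eq_bigr (fun j => `|(x j)%:Z - (y j)%:Z|%N)).
  by rewrite addnC [X in (_ + X)%N = _]addnC addnA.
by move=> j /negPf ji; rewrite ffunE ji.
Qed.

Lemma l1distxx (x : site) : l1dist x x = 0%N.
Proof. by rewrite /l1dist big1 // => i _; rewrite subrr. Qed.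

Lemma dist_le_l1dist (E : {set {set site}}) :
  (forall x y, l1dist x y = 1%N -> [set x; y] \in E) ->
  forall x y, dist_le E (l1dist x y) x y.
Proof.
move=> nn x y; move Dn: (l1dist x y) => n; elim: n x Dn => [|n IH] x xyn.
  have [->|/l1dist_gt0] := eqVneq x y; first exact: dist_le_refl.
  by rewrite xyn.
have [i xyi] : exists i, x i != y i.
  apply/existsP; apply: contraPT xyn; rewrite negb_exists => /forallP H.
  have -> : x = y by apply/ffunP => i; apply/eqP; rewrite -[_ == _]negbK.
  by rewrite l1distxx.
pose t : 'I_N.+1 := inord (if (x i < y i)%N then (x i).+1 else (x i).-1).
have tE : nat_of_ord t = if (x i < y i)%N then (x i).+1 else (x i).-1.
  by rewrite inordK //; have := ltn_ord (x i); have := ltn_ord (y i); case: ifP; lia.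
have xyi' : nat_of_ord (x i) <> y i by move/val_inj/eqP; apply/negP.
have step : l1dist x (move_coord x i t) = 1%N.
  have := l1dist_move_coord x x i t; rewrite l1distxx subrr addn0 add0n l1distC => ->.
  by rewrite tE; case: ifP; lia.
rewrite -[n.+1]add1n; apply: dist_le_trans (IH (move_coord x i t) _).
  apply: dist_le_edge (nn _ _ step).
  by apply: contra_eq_neq step => <-; rewrite l1distxx.
by have := l1dist_move_coord x y i t; rewrite xyn tE; case: ifP; lia.
Qed.

(** Among the points on the line through x in the first coordinate direction,
    at least a are at distance less than a from x. *)
Lemma exists_start_set (a : nat) (x : site) : (0 < d)%N -> (2 * a <= N.+1)%N ->
  exists2 A : {set site}, #|A| = a & {in A, forall v, l1dist x v <= a}%N.
Proof.
move=> hd aN; pose i0 := Ordinal hd.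
pose near := [set move_coord x i0 t |
  t in [pred t : 'I_N.+1 | (`|t%:Z - (x i0)%:Z| < a)%N]].
exists (subset_of_card a near).
  apply: card_subset_of_card; rewrite card_imset; first exact: card_near_ge.
  by move=> t t' /ffunP/(_ i0); rewrite !ffunE eqxx.
move=> v /(subsetP (subset_of_card_sub _ _)) /imsetP[t]; rewrite inE => ta ->.
have := l1dist_move_coord x x i0 t; rewrite l1distxx subrr addn0 add0n l1distC => ->.
exact: ltnW.
Qed.

End NearestNeighbours.

From mathcomp Require Import all_classical all_reals all_analysis.
Import numFieldNormedType.Exports.
Local Open Scope classical_set_scope.
Local Open Scope ring_scope.

(** * The law of the percolation graph *)

Section Law.
Variables (R : realType) (disp : measure_display) (T : measurableType disp).
Variables (P : probability T R) (I : finType) (A : {set I}) (G : T -> {set I}).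
Hypothesis GA : forall w, G w \subset A.
Hypothesis mG : forall e, measurable [set w | e \in G w].
Hypothesis indG : mutually_independent P A (fun e => [set w | e \in G w]).

Definition marginal (e : I) : R := fine (P [set w | e \in G w]).

Lemma marginalE e : P [set w | e \in G w] = (marginal e)%:E.
Proof. by rewrite fineK // fin_num_measure. Qed.

Lemma marginal01 e : 0 <= marginal e <= 1.
Proof. by rewrite -!lee_fin -marginalE measure_ge0 probability_le1. Qed.

Lemma measurable_fiber E : measurable [set w | G w = E].
Proof.
have -> : [set w | G w = E] =
    \bigcap_(e in [set: I]) (if e \in E then [set w | e \in G w]
                             else ~` [set w | e \in G w]).
  apply/seteqP; split=> w /=.
    by move=> GE e _; case: ifP; rewrite -GE //= => ->.
  move=> H; apply/finset.setP => e; have := H e Logic.I.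
  by case: ifP => //= eE /negP/negPf.
apply: fin_bigcap_measurable; first exact: finite_finset.
move=> e _; case: ifP => _; first exact: mG.
exact: measurableC.
Qed.

Lemma measurable_law (Q : pred {set I}) : measurable [set w | Q (G w)].
Proof.
have -> : [set w | Q (G w)] =
    \bigcup_(E in [set E | Q E]) [set w | G w = E].
  apply/seteqP; split=> w /=; first by move=> QG; exists (G w).
  by move=> [E /= QE ->].
apply: fin_bigcup_measurable; first exact: finite_finset.
by move=> E _; apply: measurable_fiber.
Qed.

Lemma law_sum (Q : pred {set I}) :
  P [set w | Q (G w)] = (\sum_(E | Q E) fine (P [set w | G w = E]))%:E.
Proof.
have H (r : seq {set I}) : uniq r -> P [set w | G w \in r] =
    (\sum_(E <- r) fine (P [set w | G w = E]))%:E.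
  elim: r => [_|E r IH /andP[Er ur]].
    rewrite big_nil (_ : [set w | _] = set0) ?measure0 //.
    by apply/seteqP; split=> w.
  rewrite (_ : [set w | _] = [set w | G w = E] `|` [set w | G w \in r]); last first.
    apply/seteqP; split=> w /=; rewrite in_cons; [move=> /orP[]|move=> []].
    - by move=> /eqP; left.
    - by right.
    - by move=> ->; rewrite eqxx.
    - by move=> ->; rewrite orbT.
  rewrite measureU /=.
  - rewrite (IH ur) big_cons EFinD; congr (_ + _)%E.
    by rewrite fineK // fin_num_measure //; apply: measurable_fiber.
  - exact: measurable_fiber.
  - exact: (measurable_law [in r]).
  - by apply/seteqP; split=> w //= -[-> Er']; rewrite Er' in Er.
rewrite -big_filter -H; last by rewrite filter_uniq ?index_enum_uniq.
by congr (P _); apply/seteqP; split=> w /=; rewrite mem_filter mem_index_enum andbT.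
Qed.

Lemma law_subset (J : {set I}) :
  P [set w | J \subset G w] = (\prod_(e in J) marginal e)%:E.
Proof.
have [JA|/fintype.subsetPn[e eJ eA]] := boolP (J \subset A).
  rewrite (_ : [set w | _] = \bigcap_(i in [set` J]) [set w | i \in G w]); last first.
    by apply/seteqP; split=> w /= /fintype.subsetP.
  rewrite indG // -prodEFin; apply: eq_bigr => e _; exact: marginalE.
have nG w : e \notin G w by apply: contra eA; apply/fintype.subsetP.
rewrite (_ : [set w | _] = set0) ?measure0; last first.
  apply/seteqP; split=> w //= /fintype.subsetP/(_ _ eJ).
  by rewrite (negPf (nG w)).
rewrite (bigD1 e) //= /marginal (_ : [set w | _] = set0) ?measure0 ?mul0r //.
by apply/seteqP; split=> w //=; rewrite (negPf (nG w)).
Qed.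

(** The two laws give the same mass to each up-set {E | J subset E}; the masses
    of the atoms are recovered from these by induction from the largest sets
    down. *)
Lemma fiber_weight E : fine (P [set w | G w = E]) = weight marginal E.
Proof.
have [n] := ubnP #|~: E|%SET; elim: n E => // n IH E En.
have : \sum_(F : {set I} | E \subset F) fine (P [set w | G w = F]) =
       \sum_(F : {set I} | E \subset F) weight marginal F.
  apply: EFin_inj; rewrite -law_sum law_subset -prob_subset; congr EFin.
  rewrite /prob /expect [RHS]big_mkcond; apply: eq_bigr => F _.
  by case: (E \subset F); rewrite ?mulr1 ?mulr0.
rewrite (bigD1 E) //= [RHS](bigD1 E) //=.
rewrite (eq_bigr (weight marginal)); first by apply: addIr.
move=> F /andP[EF FE]; apply: IH; rewrite -ltnS (leq_trans _ En) // ltnS.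
apply: proper_card; rewrite finset.properEneq finset.setCS EF andbT.
by rewrite (inj_eq (inv_inj (@finset.setCK I))).
Qed.

(** Independence of the events that e belongs to G determines the whole law of
    G, which reduces every probability to a finite sum. *)
Lemma lawE (Q : pred {set I}) : P [set w | Q (G w)] = (prob marginal Q)%:E.
Proof.
rewrite law_sum /prob /expect big_mkcond; congr EFin; apply: eq_bigr => E _.
by rewrite fiber_weight; case: (Q E); rewrite ?mulr1 ?mulr0.
Qed.

End Law.

(** * Diameter estimates in a fixed box *)

Lemma gdiam_leP (R : realType) (V : finType) (E : {set {set V}}) (n : nat) :
  (gdiam R E <= n%:R%:E)%E <-> (forall x y, dist_le E n x y).
Proof.
split=> [diam x y|H].
  have dist : (gdist R E x y <= n%:R%:E)%E.
    apply: le_trans diam; rewrite /gdiam.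
    apply: le_trans (le_bigmax _ (fun x => \big[maxe/-oo%E]_y gdist R E x y) x).
    exact: (le_bigmax _ (fun y => gdist R E x y) y).
  apply: contrapT => nw; move: dist; apply/negP; rewrite -ltNge.
  apply: (@lt_le_trans _ _ n.+1%:R%:E); first by rewrite lte_fin ltr_nat.
  apply/ereal_infP => _ [s [ps ls]] <-; rewrite lee_fin ler_nat ltnNge.
  by apply/negP => sn; apply: nw; exists s.
apply: bigmax_le => [|x _]; first exact: leNye.
apply: bigmax_le => [|y _]; first exact: leNye.
have [s [ps ls sn]] := H x y.
apply: (@le_trans _ _ (size s)%:R%:E); last by rewrite lee_fin ler_nat.
by apply: ereal_inf_lbound; exists s.
Qed.

Section FiniteBox.
Variables (R : realType) (d N : nat) (beta : R).
Hypotheses (hd : (0 < d)%N) (hbeta : 0 < beta).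
Variables (disp : measure_display) (T : measurableType disp).
Variables (P : probability T R) (G : T -> {set {set site d N}}).
Hypothesis hG : long_range_percolation beta P G.
Local Notation site := (site d N).
Local Notation p := (marginal P G).

Lemma percolation_law (Q : pred {set {set site}}) :
  P [set w | Q (G w)] = (prob p Q)%:E.
Proof. exact: (lawE (lrp_simple hG) (lrp_measurable hG) (lrp_independent hG)). Qed.

Lemma percolation_marginal01 e : 0 <= p e <= 1.
Proof. exact: (marginal01 P (lrp_measurable hG)). Qed.

Lemma percolation_marginal x y : x != y -> p [set x; y]%SET = edge_prob beta x y.
Proof.
move=> xy; have := lrp_prob hG xy.
by rewrite /edge_event (marginalE P (lrp_measurable hG)) => -[].
Qed.

Lemma card_site : #|{: site}| = (N.+1 ^ d)%N.
Proof. by rewrite card_ffun !card_ord. Qed.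

(** There are finitely many nearest-neighbour edges and each has probability 1. *)
Lemma prob_missing_neighbour (Q : pred {set {set site}}) :
  (forall E, Q E -> exists x y, l1dist x y = 1%N /\ [set x; y]%SET \notin E) ->
  prob p Q = 0.
Proof.
move=> HQ; apply/eqP; rewrite eq_le prob_ge0 ?andbT;
  last exact: percolation_marginal01.
apply: (@le_trans _ _ (prob p (fun E => [exists u : site * site,
    (l1dist u.1 u.2 == 1%N) && ([set u.1; u.2]%SET \notin E)]))).
  apply: le_prob; first exact: percolation_marginal01.
  by move=> E /HQ[x [y [xy xyE]]]; apply/existsP; exists (x, y); rewrite /= xy eqxx.
apply: le_trans (prob_exists percolation_marginal01 _) _.
rewrite big1 // => -[x y] _ /=; have [xy|xy] := eqVneq (l1dist x y) 1%N; last first.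
  by apply: prob_eq0.
rewrite /= prob_cmpl prob_mem percolation_marginal ?/edge_prob ?xy ?eqxx ?subrr //.
by apply: contra_eq_neq xy => ->; rewrite l1distxx.
Qed.

(** The bound for fixed parameters: a is the size of the starting sets, m the
    growth factor of the layers, k the number of rounds from each end, r the
    length below which edges are neglected, and n, about N / 2, a bound on the
    displacements available from any vertex. The sum is the number of vertices
    seen in one exploration; it must be so small that even twice this many
    vertices absorb at most rate 1 from any vertex. A layer of s vertices then
    fails to grow with probability at most exp(- s tau). *)
Lemma prob_diam_large (m k a r n : nat) (tau : R) :
  (0 < m)%N -> (0 < r)%N -> (r <= n)%N -> (2 * n <= N.+3)%N -> (2 * a <= N.+1)%N ->
  (2 * (a + \sum_(i < k) m ^ i.+1 * a))%:R * (beta / r%:R ^+ d) <= 1 ->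
  0 <= tau ->
  m%:R + tau <= (beta / d%:R ^+ d * ln (n%:R / r%:R) - 1) / 4 ->
  prob p (fun E => ~~ `[< forall x y, dist_le E (2 * k + 1 + 2 * a) x y >]) <=
  ((N.+1 ^ d) ^ 2)%:R * ((2 * k)%:R * expR (- (a%:R * tau)) +
    expR (- (beta / (d * N)%:R ^+ d * (m ^ k * a)%:R ^+ 2))).
Proof.
move=> m0 r0 rn nN aN Ur tau0 mtau.
set umax := (2 * _)%N in Ur.
set q := expR (- (a%:R * tau)); set s := expR (- (_ * _ ^+ 2)).
have p01 := percolation_marginal01.
(* The constant 2 of the growth bound is replaced by e, to compare exponents. *)
have Hq (A U : {set site}) : A \subset U -> (a <= #|A|)%N -> (#|U| <= umax)%N ->
    prob p (fun E => #|nbr E A U| < m * #|A|)%N <= q.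
  move=> AU aA Uu.
  apply: le_trans (prob_nbr_small p01 _ (lam := long_rate beta r)
    (eta := beta / r%:R ^+ d) (Lam :=
      beta / d%:R ^+ d * ln (n%:R / r%:R)) _ _ _ AU _) _.
  - by move=> u v; apply: long_rate_bounds.
  - by move=> u v uv; rewrite percolation_marginal //; apply: edge_prob_compl_long.
  - by move=> u; apply: sum_long_rate_ge.
  - rewrite (le_trans _ Ur) // ler_wpM2r ?ler_nat //.
    by rewrite divr_ge0 ?exprn_ge0 // ltW.
  apply: (@le_trans _ _ (expR (m * #|A|)%:R * expR (- (#|A|%:R * (m%:R + tau))))).
    apply: ler_pM; rewrite ?exprn_ge0 ?expR_ge0 //.
      rewrite -[(m * _)%:R]mulr1 expRM_natl.
      by rewrite lerXn2r ?nnegrE ?expR_ge0 // (le_trans _ (expR_ge1Dx _)).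
    by rewrite ler_expR lerN2 -mulrA ler_wpM2l.
  rewrite -expRD ler_expR natrM mulrDr (mulrC m%:R) opprD addrA subrr add0r.
  by rewrite lerN2 ler_wpM2r // ler_nat.
have Hs (A B : {set site}) : [disjoint A & B]%B -> #|A| = (m ^ k * a)%N ->
    #|B| = (m ^ k * a)%N -> prob p (fun E => [disjoint joins A B & E]%B) <= s.
  move=> AB cA cB; pose kappa := beta / (d * N)%:R ^+ d.
  apply: le_trans (prob_no_join p01 (f := fun _ _ => kappa) AB _) _.
    move=> u v uA vB; have uv : u != v.
      by apply/eqP => uv; apply: (disjointF AB uA); rewrite uv.
    rewrite percolation_marginal // (le_trans (edge_prob_compl _ _ _)) //.
    have l0 := l1dist_gt0 uv.
    rewrite ler_expR lerN2 /kappa ler_pM2l // lef_pV2 ?posrE ?exprn_gt0 ?ltr0n //.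
      by rewrite lerXn2r ?nnegrE ?ler_nat // l1dist_le_diam.
    by rewrite (leq_trans l0) // l1dist_le_diam.
  rewrite ler_expR lerN2 !sumr_const cA cB -mulrnA mulnn -[leRHS]mulr_natl natrX
    mulrC.
  exact: lexx.
have start (x : site) : exists A : {set site},
    #|A| = a /\ {in A, forall v, l1dist x v <= a}%N.
  by have [A cA HA] := exists_start_set x hd aN; exists A.
have [S Sprop] := boolp.choice start.
pose nnbad (E : {set {set site}}) :=
  `[< exists x y, l1dist x y = 1%N /\ [set x; y]%SET \notin E >].
(* Pairs whose starting sets meet are close; only the others are explored. *)
pose far x y (E : {set {set site}}) :=
  [disjoint S x & S y]%B && meet_fails m k (S x) (S y) E.
apply: (@le_trans _ _ (prob p (fun E =>
    nnbad E || [exists u : site * site, far u.1 u.2 E]))).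
  apply: le_prob => // E; apply: contraR; rewrite negb_or => /andP[nn nfar].
  apply/asboolP => x y.
  have nnE u v : dist_le E (l1dist u v) u v.
    apply: dist_le_l1dist => {}u {}v uv; apply: contraR nn => uvE.
    by apply/asboolP; exists u, v.
  have inS z v : v \in S z -> dist_le E a z v.
    by case: (Sprop z) => _ H vS; exact: dist_leW (H v vS) (nnE z v).
  have [Sxy|] := boolP [disjoint S x & S y]%B; last first.
    case/pred0Pn => z /= /andP[/inS xz /inS yz].
    apply: dist_leW (dist_le_trans xz (dist_le_sym yz)); lia.
  have nmeet : ~~ meet_fails m k (S x) (S y) E.
    apply: contra nfar => mf; apply/existsP; exists (x, y).
    by rewrite /far /= Sxy.
  have [u [v [/inS xu /inS yv uv]]] := meet_succeeds Sxy nmeet.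
  apply: dist_leW (dist_le_trans xu (dist_le_trans uv (dist_le_sym yv))); lia.
apply: le_trans (prob_or p01 _ _) _.
rewrite (prob_missing_neighbour (Q := nnbad)) ?add0r; last by move=> E /asboolP.
apply: le_trans (prob_exists p01 _) _.
have q0 : 0 <= q := expR_ge0 _.
have s0 : 0 <= s := expR_ge0 _.
rewrite -mulnn -card_site -card_prod mulr_natl -sumr_const;
  apply: ler_sum => -[x y] _ /=.
have [Sxy|Sxy] := boolP [disjoint S x & S y]%B; last first.
  rewrite prob_eq0 ?addr_ge0 ?mulr_ge0 // => E; by rewrite /far (negPf Sxy).
rewrite (eq_prob p (Q' := meet_fails m k (S x) (S y))); last first.
  by move=> E; rewrite /far Sxy.
have [[cx _] [cy _]] := (Sprop x, Sprop y).
by apply: (prob_meet_fails p01 (umax := umax) (a := a)).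
Qed.

(** A small diameter puts every vertex close to the corner 0. *)
Lemma prob_diam_small (n : nat) : (0 < N)%N ->
  (N.+1 ^ d)%:R * prob p (fun E => (gdiam R E <= n%:R%:E)%E) <=
  \sum_(j < n.+1) ((1 + beta) * (d * 2 * 3 ^ d.-1)%:R * (1 + ln N%:R)) ^+ j.
Proof.
move=> N0; rewrite -card_site.
apply: (prob_all_dist_le percolation_marginal01 (x := [ffun=> ord0])).
  move=> u; rewrite (eq_bigr (edge_prob beta u)); first exact: sum_edge_prob_le.
  by move=> v vu; rewrite percolation_marginal // eq_sym.
by move=> E /gdiam_leP HE y; apply: HE.
Qed.

End FiniteBox.

(** * Choice of the parameters *)

Lemma sum_powers_le m k : (2 <= m)%N -> (1 + \sum_(i < k) m ^ i.+1 <= 2 * m ^ k)%N.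
Proof.
move=> m2; elim: k => [|k IH]; first by rewrite big_ord0.
rewrite big_ord_recr /= addnA; have := leq_mul m2 (leqnn (m ^ k)).
by move: IH; rewrite expnS; set s := (1 + _)%N; set x := (m * _)%N; lia.
Qed.

Lemma expR_ge_powX (R : realType) (x : R) (n : nat) : 0 <= x -> (0 < n)%N ->
  (x / n%:R) ^+ n <= expR x.
Proof.
move=> x0 n0; have nR : 0 < n%:R :> R by rewrite ltr0n.
have -> : expR x = expR (x / n%:R) ^+ n by rewrite -expRM_natl mulrC divfK ?gt_eqF.
rewrite lerXn2r ?nnegrE ?expR_ge0 ?divr_ge0 ?ler0n //.
by apply: le_trans (expR_ge1Dx _); rewrite lerDr.
Qed.

(** As ln vanishes on nonpositive numbers, positivity of the iterated logarithm
    carries positivity of the inner ones. *)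
Lemma lnln_pos (R : realType) (N : nat) : 0 < ln (ln N%:R : R) ->
  [/\ (0 < N)%N, expR (ln N%:R) = N%:R :> R & expR (ln (ln N%:R)) = ln N%:R :> R].
Proof.
move=> t0; have L0 : 0 < ln N%:R :> R.
  by rewrite ltNge; apply/negP => /ln0 e; rewrite e ltxx in t0.
have N0 : 0 < N%:R :> R.
  by rewrite ltNge; apply/negP => /ln0 e; rewrite e ltxx in L0.
by split; rewrite ?lnK ?posrE // -(ltr0n R).
Qed.

Lemma truncnD1_bounds (R : realType) (x : R) : 0 <= x ->
  x <= (Num.truncn x).+1%:R <= x + 1.
Proof.
move=> x0; have /andP[h1 h2] := truncn_itv x0.
by rewrite (ltW h2) -natr1 lerD2r.
Qed.

(** The growth factor m is c L rounded down. Its logarithm is t + O(1), which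
    exceeds t / (1 + del) for large t. *)
Lemma exists_layer_growth (R : realType) (c del L t : R) :
  0 < c -> 0 < del -> 0 < t -> expR t = L -> 4 / c <= t ->
  (1 + del) * `|ln (c / 2)| / del <= t ->
  exists m : nat, [/\ (2 <= m)%N, m%:R <= c * L & t <= (1 + del) * ln m%:R].
Proof.
move=> c0 del0 t0 Lt tc tdel.
have L0 : 0 < L by rewrite -Lt expR_gt0.
have c2 : 0 < c / 2 by rewrite divr_gt0.
have tL : t <= L by rewrite -Lt (le_trans _ (expR_ge1Dx t)) // lerDr.
have cL : 4 <= c * L by rewrite mulrC -ler_pdivrMr // (le_trans tc).
exists (Num.truncn (c * L)).
have /andP[+ +] := truncn_itv (ltW (mulr_gt0 c0 L0)).
set m := Num.truncn _; rewrite -natr1 => m_le m_gt.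
have m_half : c / 2 * L <= m%:R.
  have -> : c / 2 * L = (c * L) / 2 by rewrite mulrAC.
  move: m_gt cL; move: (c * L) (m%:R : R) => x y; lra.
split=> //.
  rewrite -(ler_nat R) (le_trans _ m_half) //.
  have -> : c / 2 * L = (c * L) / 2 by rewrite mulrAC.
  by rewrite ler_pdivlMr // -natrM.
have m0 : 0 < m%:R :> R by apply: lt_le_trans m_half; apply: mulr_gt0.
have : ln (c / 2 * L) <= ln m%:R by rewrite ler_ln ?posrE ?mulr_gt0.
rewrite lnM ?posrE // -{1}Lt expRK => lnm.
have : (1 + del) * `|ln (c / 2)| <= t * del by rewrite -ler_pdivrMr.
have := ler_norm (- ln (c / 2)); rewrite normrN.
move: lnm; move: (ln (c / 2)) (`|ln (c / 2)|) (ln m%:R) => x y z.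
clear - del0 t0; nra.
Qed.

(** For D = d L / 2, the target exp(D + t) is N^(d/2) log N. The number of rounds
    is (D + t) / ln m rounded up; rounding costs a factor m at most. *)
Lemma exists_round_count (R : realType) (D t : R) (m : nat) :
  0 <= D -> 0 <= t -> (2 <= m)%N ->
  exists k : nat, [/\ expR (D + t) <= (m ^ k)%:R,
    (m ^ k)%:R <= expR (D + t) * m%:R & k%:R <= (D + t) / ln m%:R + 1].
Proof.
move=> D0 t0 m2.
have m0 : 0 < m%:R :> R by rewrite ltr0n ltnW.
have lnm0 : 0 < ln m%:R :> R by rewrite ln_gt0 // ltr1n.
have y0 : 0 <= (D + t) / ln m%:R by rewrite divr_ge0 ?(ltW lnm0) // addr_ge0.
have /andP[yk ky] := truncnD1_bounds y0.
exists (Num.truncn ((D + t) / ln m%:R)).+1; set k := _.+1 in yk ky *.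
have mkE : (m ^ k)%:R = expR (k%:R * ln m%:R) :> R.
  by rewrite natrX expRM_natl lnK.
split => //; rewrite mkE; first by rewrite ler_expR -ler_pdivrMr.
rewrite -[X in _ <= _ * X](lnK (x := m%:R)) // -expRD ler_expR.
apply: le_trans (ler_wpM2r (ltW lnm0) ky) _.
by rewrite mulrDl mul1r divfK ?gt_eqF.
Qed.

(** Here r is N^(3/4) rounded up; log(n / r) is still a fixed fraction of log N. *)
Lemma exists_length_scale (R : realType) (N : nat) : (0 < N)%N ->
  12 <= ln N%:R :> R ->
  exists r n : nat, [/\ (0 < r)%N, (r <= n)%N, (2 * n <= N.+3)%N,
    expR (3 / 4 * ln N%:R) <= r%:R :> R &
    ln N%:R / 4 - 3 <= ln (n%:R / r%:R) :> R].
Proof.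
move=> N0; set L := ln N%:R => L12.
have NL : expR L = N%:R by rewrite lnK // posrE ltr0n.
set s := expR (3 / 4 * L); set u := expR (L / 4).
have su : s * u = N%:R by rewrite -expRD -NL; congr expR; field.
have s1 : 1 <= s by rewrite -expR0 ler_expR mulr_ge0 //; lra.
have u4 : 4 <= u by apply: le_trans (expR_ge1Dx _); lra.
have s0 : 0 < s by lra.
have /andP[sr rs] := truncnD1_bounds (ltW s0).
exists (Num.truncn s).+1, (N.+3)./2; set r := _.+1 in sr rs *.
have r0 : 0 < r%:R :> R by rewrite ltr0n.
have nN : (2 * N.+3./2 <= N.+3)%N by have := odd_double_half N.+3; lia.
have Nn : N%:R / 2 <= (N.+3./2)%:R :> R.
  rewrite ler_pdivrMr // -natrM ler_nat; have := odd_double_half N.+3.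
  by case: (odd _); lia.
have rn : r%:R * (u / 4) <= (N.+3./2)%:R.
  by apply: le_trans Nn; rewrite -su; nra.
split=> //.
  by rewrite -(ler_nat R) (le_trans _ rn) // ler_peMr ?(ltW r0) // ler_pdivlMr //
    mul1r.
have u0 : 0 < u by apply: expR_gt0.
have : ln (u / 4) <= ln (N.+3./2%:R / r%:R).
  have n0 : 0 < (N.+3./2)%:R :> R.
    by apply: lt_le_trans rn; rewrite mulr_gt0 // divr_gt0.
  by rewrite ler_ln ?posrE ?divr_gt0 // ler_pdivlMr // mulrC.
apply: le_trans; rewrite ln_div ?posrE // /u expRK lerD2l lerN2.
have -> : 4 = 1 + 3 :> R by ring.
by apply: le_ln1Dx; lra.
Qed.

(** The two explorations see O(N^(d/2) (log N)^2) vertices in total, far fewer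
    than r^d >= N^(3d/4). *)
Lemma layers_sparse (R : realType) (beta c L : R) (a m k r d : nat) :
  (0 < d)%N -> (2 <= m)%N -> 0 < beta -> 0 < c -> 0 < L ->
  4 * a%:R * beta * c * 12 ^+ 2 * 12 <= L -> m%:R <= c * L ->
  (m ^ k)%:R <= expR (d%:R * L / 2) * L * m%:R ->
  expR (3 / 4 * L) <= r%:R ->
  (2 * (a + \sum_(i < k) m ^ i.+1 * a))%:R * (beta / r%:R ^+ d) <= 1.
Proof.
move=> hd m2 beta0 c0 L0 LK mcL mk sr.
have s0 : 0 < expR (3 / 4 * L) := expR_gt0 _.
have r0 : 0 < r%:R :> R by apply: lt_le_trans sr.
rewrite mulrA ler_pdivrMr ?exprn_gt0 // mul1r.
have sumle : (2 * (a + \sum_(i < k) m ^ i.+1 * a) <= 4 * a * m ^ k)%N.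
  rewrite -big_distrl /= -[X in (X + _)%N]mul1n -mulnDl.
  have := leq_mul (sum_powers_le k m2) (leqnn a); set x := (_ * a)%N.
  by rewrite -!mulnA (mulnC (m ^ k)%N); set z := (a * _)%N; lia.
apply: (@le_trans _ _ (4 * a%:R * beta * c * L ^+ 2 * expR (d%:R * L / 2))).
  apply: (@le_trans _ _ ((4 * a * m ^ k)%:R * beta)).
    by rewrite ler_wpM2r ?(ltW beta0) // ler_nat.
  apply: (@le_trans _ _ (4 * a%:R * (expR (d%:R * L / 2) * L * (c * L)) * beta)).
    rewrite ler_wpM2r ?(ltW beta0) // 2!natrM ler_wpM2l ?mulr_ge0 //.
    apply: le_trans mk _; rewrite ler_wpM2l // mulr_ge0 ?expR_ge0 // ltW //.
  by rewrite le_eqVlt; apply/orP; left; apply/eqP; ring.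
(* A quadratic in L is absorbed by exp(L / 4) through the cube of L / 12. *)
apply: (@le_trans _ _ (expR (L / 4) * expR (d%:R * L / 2))).
  rewrite ler_wpM2r ?expR_ge0 //.
  have -> : L / 4 = 3%:R * (L / 12) by field.
  rewrite expRM_natl; apply: (@le_trans _ _ ((L / 12) ^+ 3)).
    have -> : 4 * a%:R * beta * c * L ^+ 2 =
        4 * a%:R * beta * c * 12 ^+ 2 * (L / 12) ^+ 2.
      by rewrite expr_div_n; field.
    rewrite [leRHS]exprS ler_wpM2r ?exprn_ge0 ?divr_ge0 ?(ltW L0) //.
    by rewrite ler_pdivlMr.
  rewrite lerXn2r ?nnegrE ?expR_ge0 ?divr_ge0 ?(ltW L0) //.
  by apply: le_trans (expR_ge1Dx _); rewrite lerDr.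
apply: (@le_trans _ _ (expR (3 / 4 * L) ^+ d)); last first.
  by rewrite lerXn2r ?nnegrE ?expR_ge0 ?(ltW r0).
rewrite -expRM_natl -expRD ler_expR.
have : 1 <= d%:R :> R by rewrite ler1n.
by move: (d%:R : R) => x; clear - L0; nra.
Qed.

(** The last layers have at least N^(d/2) L vertices each, hence at least
    N^d L^2 pairs, and a pair is joined at rate at least beta / (d N)^d. *)
Lemma meeting_rate (R : realType) (beta L : R) (a m k d N : nat) :
  (0 < d)%N -> 0 < beta -> 0 < L -> expR L = N%:R -> (0 < a)%N ->
  (2 * d%:R + 2) / (beta / d%:R ^+ d) <= L ->
  expR (d%:R * L / 2) * L <= (m ^ k)%:R ->
  (2 * d%:R + 2) * L <= beta / (d * N)%:R ^+ d * (m ^ k * a)%:R ^+ 2.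
Proof.
move=> hd beta0 L0 NL a0 Lc mk.
have d0 : 0 < d%:R :> R by rewrite ltr0n.
have N0 : 0 < N%:R :> R by rewrite -NL expR_gt0.
have c0 : 0 < beta / d%:R ^+ d by rewrite divr_gt0 ?exprn_gt0.
have mka : expR (d%:R * L / 2) * L <= (m ^ k * a)%:R.
  by apply: le_trans mk _; rewrite ler_nat leq_pmulr.
apply: (@le_trans _ _ (beta / (d * N)%:R ^+ d * (expR (d%:R * L / 2) * L) ^+ 2)).
  have -> : beta / (d * N)%:R ^+ d * (expR (d%:R * L / 2) * L) ^+ 2 =
      beta / d%:R ^+ d * L * L.
    have E2 : expR (d%:R * L / 2) ^+ 2 = N%:R ^+ d.
      by rewrite -NL -!expRM_natl; congr expR; field.
    by rewrite natrM !exprMn E2; field; rewrite !expf_neq0 ?gt_eqF.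
  by rewrite ler_wpM2r ?(ltW L0) // [leRHS]mulrC -ler_pdivrMr.
rewrite ler_wpM2l ?divr_ge0 ?exprn_ge0 ?(ltW beta0) //.
by rewrite lerXn2r ?nnegrE ?mulr_ge0 ?expR_ge0 ?(ltW L0).
Qed.

(** There are (N+1)^(2d) <= 4^d N^(2d) pairs, and the failure probability of each
    is at most 3 N times N^(- 2 d - 2). *)
Lemma union_bound_small (R : realType) (L q s : R) (d k N : nat) :
  expR L = N%:R -> (0 < N)%N -> k%:R <= N%:R :> R ->
  q <= expR (- ((2 * d%:R + 2) * L)) -> s <= expR (- ((2 * d%:R + 2) * L)) ->
  ((N.+1 ^ d) ^ 2)%:R * ((2 * k)%:R * q + s) <= (4 ^ d * 3)%:R / N%:R.
Proof.
move=> NL N0 kN; have NR : 0 < N%:R :> R by rewrite ltr0n.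
have -> : expR (- ((2 * d%:R + 2) * L)) = (N%:R ^+ (2 * d + 2))^-1.
  by rewrite expRN -natrM -natrD expRM_natl NL.
set e := (_ ^+ _)^-1 => qe se.
have e0 : 0 < e by rewrite invr_gt0 exprn_gt0.
have N1 : 1 <= N%:R :> R by rewrite ler1n.
have qs : (2 * k)%:R * q + s <= 3 * N%:R * e.
  have kq : (2 * k)%:R * q <= (2 * N)%:R * e.
    apply: (@le_trans _ _ ((2 * k)%:R * e)); first by rewrite ler_wpM2l.
    by rewrite ler_wpM2r ?(ltW e0) // !natrM ler_wpM2l.
  have sN : s <= N%:R * e by apply: le_trans se _; rewrite ler_peMl // ltW.
  apply: le_trans (lerD kq sN) _; rewrite natrM -!mulrA.
  by move: (N%:R * e) => x; clear; lra.
apply: (@le_trans _ _ (((2 * N) ^ (2 * d))%:R * (3 * N%:R * e))).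
  apply: le_trans (ler_wpM2l (ler0n _ _) qs) _.
  rewrite ler_wpM2r ?mulr_ge0 ?(ltW e0) // ler_nat -expnM mulnC.
  by case: (2 * d)%N => // j; rewrite leq_exp2r //; lia.
rewrite le_eqVlt; apply/orP; left; apply/eqP.
have -> : ((2 * N) ^ (2 * d))%:R = 4%:R ^+ d * N%:R ^+ (2 * d) :> R.
  by rewrite natrX natrM exprMn exprM (_ : 2 ^+ 2 = 4) //; ring.
rewrite /e exprD natrM natrX; field.
by rewrite !expf_neq0 // gt_eqF.
Qed.

(** Up to a factor 1 + eps / 2 and a bounded term, 2 k is d L / t; the remaining
    eps / 2 of d L / t, which tends to infinity, absorbs the rest. *)
Lemma distance_bound (R : realType) (d a k m : nat) (L t eps : R) :
  (0 < d)%N -> (2 <= m)%N -> 0 < eps -> 0 < t -> expR t = L ->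
  8 * (5 + eps + 2 * a%:R) / eps <= t ->
  t <= (1 + eps / 2) * ln m%:R ->
  k%:R <= (d%:R * L / 2 + t) / ln m%:R + 1 ->
  (2 * k + 1 + 2 * a)%:R <= (1 + eps) * d%:R * L / t.
Proof.
move=> hd m2 eps0 t0 Lt teps tm kb.
have d1 : 1 <= d%:R :> R by rewrite ler1n.
have L0 : 0 < L by rewrite -Lt expR_gt0.
have lnm0 : 0 < ln m%:R :> R by rewrite ln_gt0 // ltr1n.
have D0 : 0 <= d%:R * L / 2 + t by rewrite addr_ge0 ?(ltW t0) // !mulr_ge0 // ltW.
have ilnm : (ln m%:R)^-1 <= (1 + eps / 2) / t.
  by rewrite ler_pdivlMr // mulrC ler_pdivrMr.
have {}kb := le_trans kb (lerD (ler_wpM2l D0 ilnm) (lexx 1)).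
have t2L : t / 4 <= L / t.
  rewrite ler_pdivlMr // -Lt; apply: le_trans (expR_ge_powX (ltW t0) (n := 2) isT).
  by rewrite le_eqVlt; apply/orP; left; apply/eqP; field.
have z_eps : 2 * (5 + eps + 2 * a%:R) <= eps * (L / t).
  move: teps; rewrite ler_pdivrMr // => teps.
  apply: (@le_trans _ _ (eps * (t / 4))); last by rewrite ler_wpM2l ?(ltW eps0).
  by move: teps; clear; lra.
have -> : (1 + eps) * d%:R * L / t = (1 + eps) * d%:R * (L / t) by rewrite mulrA.
have {}kb : k%:R <= (d%:R * (L / t) / 2 + 1) * (1 + eps / 2) + 1.
  apply: le_trans kb _; rewrite lerD2r le_eqVlt; apply/orP; left; apply/eqP.
  by field; rewrite gt_eqF.
rewrite (natrD _ (2 * k + 1)%N) (natrD _ (2 * k)%N) !(natrM _ 2).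
have zpos : 0 < L / t by rewrite divr_gt0.
move: (L / t) zpos z_eps kb => z z0 z_eps kb.
have : eps * z <= d%:R * (eps * z) by rewrite ler_peMl // mulr_ge0 ?(ltW eps0)
  ?(ltW z0).
move: kb z_eps; clear; move: (d%:R : R) (k%:R : R) (a%:R : R) => x y w.
by have -> : 1%:R = 1 :> R by []; nra.
Qed.

Lemma round_count_le (R : realType) (L t del : R) (d k m N : nat) :
  (0 < d)%N -> (2 <= m)%N -> 0 < del -> 1 <= t -> t <= L -> expR L = N%:R ->
  4 * ((1 + del) * (d%:R / 2 + 1) + 1) <= L ->
  t <= (1 + del) * ln m%:R ->
  k%:R <= (d%:R * L / 2 + t) / ln m%:R + 1 ->
  k%:R <= N%:R :> R.
Proof.
move=> hd m2 del0 t1 tL NL LK tm kb.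
have lnm0 : 0 < ln m%:R :> R by rewrite ln_gt0 // ltr1n.
have L0 : 0 < L by apply: lt_le_trans tL; apply: lt_le_trans t1.
have ilnm : (ln m%:R)^-1 <= 1 + del.
  by rewrite -[leLHS]mul1r ler_pdivrMr // (le_trans t1).
have D0 : 0 <= d%:R * L / 2 + L by rewrite addr_ge0 ?(ltW L0) // !mulr_ge0 // ltW.
apply: le_trans kb _.
apply: (@le_trans _ _ ((d%:R * L / 2 + L) * (1 + del) + 1)).
  rewrite lerD2r; apply: (@le_trans _ _ ((d%:R * L / 2 + L) / ln m%:R)).
    by rewrite ler_pM2r ?invr_gt0 // lerD2l.
  by rewrite ler_wpM2l.
have -> : (d%:R * L / 2 + L) * (1 + del) + 1 = (1 + del) * (d%:R / 2 + 1) * L + 1.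
  by field.
have : (L / 2%:R) ^+ 2 <= N%:R by rewrite -NL; apply: expR_ge_powX => //; exact: ltW.
apply: le_trans; move: LK; set K := (1 + del) * _ => LK.
have L1 : 1 <= L by apply: le_trans tL.
apply: (@le_trans _ _ ((K + 1) * L)); first by rewrite mulrDl mul1r lerD2l.
have -> : (L / 2) ^+ 2 = L / 4 * L by field.
by rewrite ler_wpM2r ?(ltW L0) // ler_pdivlMr // mulrC.
Qed.

(** The constants are fixed in this order: c1 is a small multiple of
    c = beta / d^d, leaving room for m + tau <= 2 c1 L below c L / 16; then a is so
    large that a tau = a c1 L is at least (2 d + 2) L, which makes a failed
    round less likely than N^(- 2 d - 2). *)
Lemma exists_exploration_parameters (R : realType) (d : nat) (beta eps : R) :
  (0 < d)%N -> 0 < beta -> 0 < eps ->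
  exists (a : nat) (B : R), forall N : nat, B <= ln (ln N%:R) ->
  exists (m k r n : nat) (tau : R),
  ([/\ (0 < m)%N, (0 < r)%N, (r <= n)%N, (2 * n <= N.+3)%N & (2 * a <= N.+1)%N] /\
  [/\ (2 * (a + \sum_(i < k) m ^ i.+1 * a))%:R * (beta / r%:R ^+ d) <= 1,
   0 <= tau,
   m%:R + tau <= (beta / d%:R ^+ d * ln (n%:R / r%:R) - 1) / 4,
   (2 * k + 1 + 2 * a)%:R <= (1 + eps) * d%:R * ln N%:R / ln (ln N%:R) &
   ((N.+1 ^ d) ^ 2)%:R * ((2 * k)%:R * expR (- (a%:R * tau)) +
      expR (- (beta / (d * N)%:R ^+ d * (m ^ k * a)%:R ^+ 2))) <=
   (4 ^ d * 3)%:R / N%:R]).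
Proof.
move=> hd hbeta heps.
have d0 : 0 < d%:R :> R by rewrite ltr0n.
have [c [cE c0]] : exists c, beta / d%:R ^+ d = c /\ 0 < c.
  by exists (beta / d%:R ^+ d); rewrite divr_gt0 ?exprn_gt0.
have [c1 [c1E c10]] : exists c1, c = 64 * c1 /\ 0 < c1.
  by exists (c / 64); rewrite divr_gt0 // mulrC divfK.
have [a a0 ac1] : exists2 a : nat, (0 < a)%N & 2 * d%:R + 2 <= a%:R * c1.
  have /truncnD1_bounds/andP[aq _] : 0 <= (2 * d%:R + 2) / c1.
    by rewrite divr_ge0 ?(ltW c10) // addr_ge0 // mulr_ge0 // ltW.
  by exists (Num.truncn ((2 * d%:R + 2) / c1)).+1; rewrite // -ler_pdivrMr.
pose del := eps / 2.
have del0 : 0 < del by rewrite divr_gt0.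
(* All lower bounds on t = log log N needed below, gathered in a list. *)
pose bs := [:: 12; 4 / c1; 24 + 8 / c; 4 * a%:R * beta * c1 * 12 ^+ 2 * 12; 2 * a%:R;
  (2 * d%:R + 2) / c; 4 * ((1 + del) * (d%:R / 2 + 1) + 1);
  (1 + del) * `|ln (c1 / 2)| / del; 8 * (5 + eps + 2 * a%:R) / eps].
exists a, (\sum_(b <- bs) `|b|) => N Bt.
set L := ln N%:R in Bt *; set t := ln L in Bt *.
have hb b : b \in bs -> b <= t.
  move=> bb; apply: le_trans Bt; apply: le_trans (ler_norm b) _.
  rewrite (perm_big _ (perm_to_rem bb)) big_cons lerDl.
  exact: sumr_ge0.
have t12 : 12 <= t by apply: hb; rewrite !inE eqxx.
have t0 : 0 < t by apply: lt_le_trans t12.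
have [N0 NL Lt] := lnln_pos t0; rewrite -/L -/t in NL Lt.
have tL : t <= L by rewrite -Lt (le_trans _ (expR_ge1Dx t)) // lerDr.
have hL b : b \in bs -> b <= L by move=> /hb /le_trans; apply.
have L0 : 0 < L by apply: lt_le_trans tL.
have [m [m2 mcL tm]] : exists m : nat,
    [/\ (2 <= m)%N, m%:R <= c1 * L & t <= (1 + del) * ln m%:R].
  by apply: exists_layer_growth; rewrite ?hb // !inE eqxx ?orbT.
have D0 : 0 <= d%:R * L / 2 by rewrite !mulr_ge0 // ltW.
have [k []] := exists_round_count D0 (ltW t0) m2; rewrite expRD Lt => mk_ge mk_le kb.
have [r [n [r0 rn nN sr lnr]]] : exists r n : nat, [/\ (0 < r)%N, (r <= n)%N,
    (2 * n <= N.+3)%N, expR (3 / 4 * L) <= r%:R & L / 4 - 3 <= ln (n%:R / r%:R)].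
  by apply: exists_length_scale => //; apply: hL; rewrite !inE eqxx.
exists m, k, r, n, (c1 * L); do 2!split => //.
- exact: ltnW.
- rewrite -(ler_nat R) (@le_trans _ _ L) //.
    by rewrite natrM hL // !inE eqxx ?orbT.
  rewrite -natr1 -NL; apply: le_trans (lerD (expR_ge1Dx L) (lexx 1)).
  by rewrite addrAC lerDr.
- apply: (layers_sparse hd m2 hbeta c10 L0 _ mcL mk_le sr).
  by rewrite hL // !inE eqxx ?orbT.
- by rewrite mulr_ge0 // ltW.
- rewrite cE; have : 24 + 8 / c <= L by rewrite hL // !inE eqxx ?orbT.
  rewrite -(ler_pM2l c0) mulrDr mulrCA divff ?gt_eqF // mulr1 => cL.
  have : c * (L / 4 - 3) <= c * ln (n%:R / r%:R) by rewrite ler_wpM2l // ltW.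
  move: mcL cL; rewrite mulrBr c1E; move: (ln (n%:R / r%:R)) => x.
  rewrite -!mulrA; move: (m%:R : R) => z.
  have -> : c1 * (L / 4) = c1 * L / 4 by rewrite mulrA.
  by move: (c1 * x) (c1 * L) => u v; clear; lra.
- by apply: (distance_bound hd m2 heps t0 Lt _ tm kb); rewrite hb // !inE eqxx ?orbT.
- apply: (union_bound_small NL N0).
  + apply: (round_count_le hd m2 del0 _ tL NL _ tm kb).
      by apply: le_trans t12; rewrite ler1n.
    by rewrite hL // !inE eqxx ?orbT.
  + by rewrite ler_expR lerN2 mulrA ler_wpM2r // ltW.
  + rewrite ler_expR lerN2; apply: (meeting_rate hd hbeta L0 NL a0 _ mk_ge).
    by rewrite cE hL // !inE eqxx ?orbT.
Qed.

(** * Limits *)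

(** With Delta = K (1 + L), the sum is at most (n+1) Delta^n, of logarithm at
    most n (t + O(1)). Taking n just above y, with y t = (1 - eps) d L,
    the main term is (1 - eps) d L; the error y O(1) + O(t) is below eps d L / 2
    for large t. *)
Lemma walks_negligible (R : realType) (d : nat) (K eps : R) :
  (0 < d)%N -> 1 <= K -> 0 < eps < 1 ->
  exists B : R, forall N : nat, B <= ln (ln N%:R) -> exists n : nat,
  (1 - eps) * d%:R * ln N%:R / ln (ln N%:R) <= n%:R /\
  \sum_(j < n.+1) (K * (1 + ln N%:R)) ^+ j <=
    (N.+1 ^ d)%:R * expR (- (eps / 2 * ln N%:R)).
Proof.
move=> hd K1 /andP[eps0 eps1].
have d1 : 1 <= d%:R :> R by rewrite ler1n.
have [Lam [LamE Lam1]] : exists Lam, Lam = ln (2 * K) + 1 /\ 1 <= Lam.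
  by eexists; split; rewrite // lerDr ln_ge0 // -[leLHS]mul1r ler_pM // ler1n.
exists (Lam + 32 / eps + 4 * Lam / eps) => N.
set L := ln N%:R; set t := ln L => Bt.
have i0 : 0 < 32 / eps by rewrite divr_gt0.
have Lam0 : 0 <= Lam by apply: le_trans Lam1.
have i1 : 0 <= 4 * Lam / eps by rewrite divr_ge0 ?mulr_ge0 ?(ltW eps0).
have tLam : Lam <= t.
  by apply: le_trans Bt; rewrite -addrA lerDl addr_ge0 // ltW.
have t32 : 32 <= t * eps.
  rewrite -ler_pdivrMr // (le_trans _ Bt) // -addrA addrCA lerDl.
  by rewrite addr_ge0.
have t4 : 4 * Lam <= t * eps.
  rewrite -ler_pdivrMr // (le_trans _ Bt) // lerDr.
  by rewrite addr_ge0 // ltW.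
clear Bt i0 i1.
have t1 : 1 <= t by apply: le_trans tLam.
have t0 : 0 < t by apply: lt_le_trans t1.
have [N0 NL Lt] := lnln_pos t0; rewrite -/L -/t in NL Lt.
have t2L : (t / 2) ^+ 2 <= L by rewrite -Lt; apply: expR_ge_powX => //; exact: ltW.
have tL : t <= L by rewrite -Lt (le_trans _ (expR_ge1Dx t)) // lerDr.
have L1 : 1 <= L by apply: le_trans tL.
have L0 : 0 < L by apply: lt_le_trans L1.
set y := (1 - eps) * d%:R * L / t.
have y0 : 0 <= y.
  by rewrite divr_ge0 ?mulr_ge0 ?(ltW t0) ?(ltW L0) // subr_ge0 ltW.
have /andP[yn ny] := truncnD1_bounds y0.
exists (Num.truncn y).+1; set n := _.+1 in yn ny *; split=> //.
have K0 : 0 < K by apply: lt_le_trans K1.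
have Delta1 : 1 <= K * (1 + L) by rewrite -[leLHS]mul1r ler_pM // lerDl ltW.
have DeltaE : K * (1 + L) <= expR (Lam - 1 + t).
  rewrite expRD Lt LamE addrK lnK ?posrE ?mulr_gt0 //.
  by rewrite -mulrA mulrCA ler_pM2l // mulrDl mul1r lerD2r.
apply: (@le_trans _ _ (n.+1%:R * (K * (1 + L)) ^+ n)).
  rewrite -[n.+1 in leRHS]card_ord mulr_natl -sumr_const; apply: ler_sum => j _.
  by rewrite ler_weXn2l // -ltnS.
(* The factor n + 1 <= exp n accounts for the extra 1 in Lam. *)
apply: (@le_trans _ _ (expR (n%:R * (Lam + t)))).
  have -> : n%:R * (Lam + t) = n%:R + n%:R * (Lam - 1 + t) by ring.
  have D0 : 0 <= K * (1 + L) by apply: le_trans Delta1.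
  rewrite expRD expRM_natl; apply: ler_pM => //; first exact: exprn_ge0.
    by rewrite -natr1 addrC expR_ge1Dx.
  by rewrite lerXn2r ?nnegrE ?expR_ge0.
apply: (@le_trans _ _ (expR (d%:R * L) * expR (- (eps / 2 * L)))); last first.
  rewrite ler_wpM2r ?expR_ge0 // expRM_natl NL -natrX ler_nat.
  by rewrite leq_exp2r.
rewrite -expRD ler_expR.
have Lt0 : 0 <= Lam + t by rewrite addr_ge0 ?(ltW t0).
apply: le_trans (ler_wpM2r Lt0 ny) _.
have yt : y * t = (1 - eps) * (d%:R * L) by rewrite /y divfK ?mulrA // gt_eqF.
have dL0 : 0 <= d%:R * L by rewrite mulr_ge0 // ltW.
have yLam : 4 * (y * Lam) <= eps * (d%:R * L).
  apply: (@le_trans _ _ (y * (t * eps))); first by rewrite mulrCA ler_wpM2l.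
  have -> : y * (t * eps) = eps * (y * t) by ring.
  rewrite yt ler_wpM2l ?(ltW eps0) //.
  by rewrite ler_piMl // gerBl ltW.
have t2 : 8 * t <= eps * L.
  apply: (@le_trans _ _ (eps * (t / 2) ^+ 2)); last by rewrite ler_wpM2l ?(ltW eps0).
  have -> : eps * (t / 2) ^+ 2 = t * eps / 4 * t by field.
  rewrite ler_wpM2r ?(ltW t0) // ler_pdivlMr // (le_trans _ t32) //.
  by rewrite -natrM.
have eL : eps * L <= eps * (d%:R * L).
  by rewrite ler_wpM2l ?(ltW eps0) // ler_peMl // ltW.
rewrite mulrDl mul1r mulrDr yt mulrBl mul1r.
have -> : eps / 2 * L = eps * L / 2 by rewrite mulrAC.
move: yLam t2 eL tLam; move: (eps * (d%:R * L)) (eps * L) (y * Lam) (d%:R * L).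
by clear => a b e f; lra.
Qed.

Lemma near_lnln (R : realType) (B : R) : \forall N \near \oo, B <= ln (ln N%:R).
Proof.
have : \forall N \near \oo, expR (expR B) <= N%:R :> R := nbhs_infty_ger _.
apply: filterS => N BN.
have N0 : 0 < N%:R :> R by apply: lt_le_trans BN; apply: expR_gt0.
have L : expR B <= ln N%:R by rewrite -[leLHS]expRK ler_ln ?posrE ?expR_gt0.
rewrite -[leLHS]expRK ler_ln ?posrE ?expR_gt0 //.
by apply: lt_le_trans L; apply: expR_gt0.
Qed.

Lemma cvg_EFin_dist (R : realType) (u : nat -> \bar R) (l : R) :
  (forall e : R, 0 < e -> \forall N \near \oo,
     ((l - e)%:E <= u N <= (l + e)%:E)%E) -> u @ \oo --> l%:E.
Proof.
move=> H; apply/fine_cvgP; split.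
  apply: filterS (H 1 ltr01) => N.
  by case: (u N) => [r| |]; rewrite ?leye_eq ?leeNy_eq ?andbF.
apply/cvgrPdist_le => e e0; apply: filterS (H e e0) => N /andP[].
case E : (u N) => [r| |] //=; rewrite !lee_fin => h1 h2.
by rewrite E /= distrC ler_distl h1 h2.
Qed.

Lemma prob_diam_above (R : realType) (d : nat) (beta eps : R) :
  (0 < d)%N -> 0 < beta -> 0 < eps ->
  exists B C : R, 0 <= C /\
  forall (N : nat) (disp : measure_display) (T : measurableType disp)
    (P : probability T R) (G : T -> {set {set site d N}}),
  long_range_percolation beta P G -> B <= ln (ln N%:R) ->
  prob (marginal P G) (fun E => ~~ (gdiam R E <=
    ((1 + eps) * d%:R * ln N%:R / ln (ln N%:R))%:E)%E) <= C / N%:R.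
Proof.
move=> hd beta0 eps0; have [a [B HB]] := exists_exploration_parameters hd beta0 eps0.
exists B, (4 ^ d * 3)%:R; split=> // N disp T P G hG /HB.
move=> [m [k [r [n [tau [[m0 r0 rn nN aN] [Ur tau0 mtau kb fin]]]]]]].
apply: le_trans fin.
apply: le_trans (prob_diam_large hd beta0 hG m0 r0 rn nN aN Ur tau0 mtau).
apply: le_prob; first exact: percolation_marginal01 hG.
move=> E; apply: contra => /asboolP/(@gdiam_leP R) diam.
by apply: le_trans diam _; rewrite lee_fin.
Qed.

Lemma prob_diam_below (R : realType) (d : nat) (beta eps : R) :
  (0 < d)%N -> 0 < beta -> 0 < eps < 1 ->
  exists B : R,
  forall (N : nat) (disp : measure_display) (T : measurableType disp)
    (P : probability T R) (G : T -> {set {set site d N}}),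
  long_range_percolation beta P G -> (0 < N)%N -> B <= ln (ln N%:R) ->
  prob (marginal P G) (fun E => (gdiam R E <=
    ((1 - eps) * d%:R * ln N%:R / ln (ln N%:R))%:E)%E) <=
  expR (- (eps / 2 * ln N%:R)).
Proof.
move=> hd beta0 eps01.
have K1 : 1 <= (1 + beta) * (d * 2 * 3 ^ d.-1)%:R.
  rewrite -[leLHS]mul1r ler_pM // ?lerDl ?(ltW beta0) //.
  by rewrite ler1n !muln_gt0 hd expn_gt0.
have [B HB] := walks_negligible hd K1 eps01.
exists B => N disp T P G hG N0 /HB[n [yn small]].
have V0 : 0 < (N.+1 ^ d)%:R :> R by rewrite ltr0n expn_gt0.
rewrite -(ler_pM2l V0); apply: le_trans small.
apply: le_trans (prob_diam_small hd beta0 hG n N0).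
rewrite ler_pM2l //; apply: le_prob; first exact: percolation_marginal01 hG.
by move=> E /le_trans; apply; rewrite lee_fin.
Qed.

Theorem theorem1p2 (R : realType) (d : nat) (hd : (1 <= d)%N)
    (beta : R) (hbeta : 0 < beta)
    (disp : nat -> measure_display)
    (T : forall N : nat, measurableType (disp N))
    (P : forall N : nat, probability (T N) R)
    (G : forall N : nat, T N -> {set {set site d N}})
    (hG : forall N : nat, (1 <= N)%N ->
      long_range_percolation beta (P N) (G N)) :
  (forall eps : R, 0 < eps ->
    P N [set w | (gdiam R (G N w) <=
                  ((1 + eps) * d%:R * ln N%:R / ln (ln N%:R))%:E)%E]
      @[N --> \oo] --> 1%E) /\
  cvg_in_probability P
    (fun N w => (gdiam R (G N w) * (ln (ln N%:R) / ln N%:R)%:E)%E) d%:R.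
Proof.
have above eps : 0 < eps -> forall e : R, 0 < e -> \forall N \near \oo,
    (0 < N)%N /\ prob (marginal (P N) (G N)) (fun E => ~~ (gdiam R E <=
      ((1 + eps) * d%:R * ln N%:R / ln (ln N%:R))%:E)%E) <= e.
  move=> eps0 e e0; have [B [C [C0 H]]] := prob_diam_above hd hbeta eps0.
  near=> N; have t1 : 1 <= ln (ln N%:R) :> R by near: N; apply: near_lnln.
  have [N0 NL Lt] := lnln_pos (lt_le_trans ltr01 t1).
  split=> //; apply: le_trans (H _ _ _ _ _ (hG N N0) _) _.
    by near: N; apply: near_lnln.
  (* C / N <= e since C / e <= ln (ln N) <= N. *)
  rewrite ler_pdivrMr ?ltr0n // mulrC -ler_pdivrMr //.
  apply: (@le_trans _ _ (ln (ln N%:R))); first by near: N; apply: near_lnln.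
  rewrite -[leRHS]NL -[leLHS]addr0 (le_trans _ (expR_ge1Dx _)) // addrC lerD //.
  by rewrite -[leRHS]Lt (le_trans _ (expR_ge1Dx _)) // lerDr.
have below eps : 0 < eps < 1 -> forall e : R, 0 < e -> \forall N \near \oo,
    prob (marginal (P N) (G N)) (fun E => (gdiam R E <=
      ((1 - eps) * d%:R * ln N%:R / ln (ln N%:R))%:E)%E) <= e.
  move=> eps01 e e0; have [B H] := prob_diam_below hd hbeta eps01.
  have /andP[eps0 _] := eps01.
  near=> N; have t1 : 1 <= ln (ln N%:R) :> R by near: N; apply: near_lnln.
  have [N0 NL Lt] := lnln_pos (lt_le_trans ltr01 t1).
  apply: le_trans (H _ _ _ _ _ (hG N N0) N0 _) _.
    by near: N; apply: near_lnln.
  rewrite expRN -[leRHS]invrK lef_pV2 ?posrE ?expR_gt0 ?invr_gt0 //.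
  apply: le_trans (expR_ge1Dx _); rewrite ler_wpDl // mulrC -ler_pdivrMr ?divr_gt0 //.
  apply: (@le_trans _ _ (ln (ln N%:R))); first by near: N; apply: near_lnln.
  by rewrite -[leRHS]Lt (le_trans _ (expR_ge1Dx _)) // lerDr.
split=> [eps eps0|delta delta0].
  apply: cvg_EFin_dist => e e0; apply: filterS (above _ eps0 _ e0) => N [N0 bad].
  rewrite (percolation_law (hG N N0) (fun E => (gdiam R E <= _)%E)) !lee_fin.
  have p01 := percolation_marginal01 (hG N N0).
  move: bad; rewrite prob_cmpl => bad; rewrite lerBlDl -lerBlDr bad /=.
  by rewrite (le_trans (prob_le1 p01 _)) // lerDl ltW.
have d0 : 0 < d%:R :> R by rewrite ltr0n.
(* Chosen so that eps < 1 and d eps <= delta. *)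
pose eps := delta / (d%:R + delta).
have dd0 : 0 < d%:R + delta by rewrite addr_gt0.
have eps01 : 0 < eps < 1 by rewrite divr_gt0 //= ltr_pdivrMr // mul1r ltrDr.
have /andP[eps0 eps1] := eps01.
have eps_d : eps * d%:R <= delta.
  by rewrite mulrAC ler_pdivrMr // ler_pM2l // lerDl ltW.
apply: cvg_EFin_dist => e e0.
have e20 : 0 < e / 2 by rewrite divr_gt0.
apply: filterS3 (above _ eps0 _ e20) (below _ eps01 _ e20) (near_lnln 1).
move=> N [N0 hi] lo t1.
have p01 := percolation_marginal01 (hG N N0).
have t0 : 0 < ln (ln N%:R) :> R by apply: lt_le_trans t1.
have [_ NL Lt] := lnln_pos t0.
have L0 : 0 < ln N%:R :> R by rewrite -Lt expR_gt0.
rewrite (percolation_law (hG N N0) (fun E =>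
  (delta%:E < `|gdiam R E * (ln (ln N%:R) / ln N%:R)%:E - d%:R%:E|)%E)).
rewrite !lee_fin sub0r add0r; apply/andP; split.
  by apply: le_trans (prob_ge0 p01 _); rewrite oppr_le0 ltW.
have -> : e = e / 2 + e / 2 by field.
apply: le_trans (lerD hi lo); apply: le_trans (prob_or p01 _ _).
apply: le_prob => // E /=; apply: contraLR; rewrite negb_or negbK -leNgt -ltNge.
(* Between the two thresholds the diameter is finite, which excludes +oo and -oo. *)
case: (gdiam R E) => [x| |] /andP[] //; rewrite lee_fin lte_fin => xhi xlo.
rewrite -EFinM -EFinB abse_EFin lee_fin.
set s := _ / _; have s0 : 0 < s by rewrite divr_gt0.
have hiE : x * s <= (1 + eps) * d%:R.
  rewrite mulrA ler_pdivrMr // -ler_pdivlMr //.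
have loE : (1 - eps) * d%:R <= x * s.
  by rewrite mulrA ler_pdivlMr // -ler_pdivrMr // ltW.
rewrite ler_distl; apply/andP; split.
  by apply: le_trans loE; rewrite mulrBl mul1r lerB.
by apply: le_trans hiE _; rewrite mulrDl mul1r lerD.
Unshelve. all: by end_near.
Qed.
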